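(* Playing the spectral game (described in the context) with a choice of diffusion parameters $\Delta$ for which no edge label equals a finite sum of any other edge labels (all labels being positive integers) allows the player to reconstruct the unknown graph $G$.
   Context: Graphs are finite and simple. A diffusion pair $(G,\Delta)$ is a graph $G$ together with diffusion parameters $\Delta=(\alpha_{ab})$, which assign to each edge $e=ab$ of $G$ a positive integer $\alpha_e=\alpha_{ab}$, called its edge label. Let $K$ be a non-Archimedean local field with absolute value $|\cdot|_K$ and residue field of cardinality $q$, a power of the prime $p$. For $\alpha>0$ the Vladimirov operator on $L^2(K)$ is $\Delta^\alpha=\mathscr{F}^{-1}|\cdot|_K^\alpha\mathscr{F}$, with $\mathscr{F}$ the Fourier transform. There is an orthonormal basis of $L^2(K)$ of Kozyrev wavelets $\psi_{r,n}$ ($r\in\mathbb{Z}$, $n\in\mathbb{N}$) with $\Delta^{\alpha}\psi_{r,n}=q^{\alpha(1-r)}\psi_{r,n}$. Let $C=(C_{ab})$ be the adjacency matrix of $G$. The $p$-adic Laplacian $\Lambda_G^\Delta$ associated with $(G,\Delta)$ is the operator on $L^2(K)^{|G|}$ (one copy of $L^2(K)$ for each vertex) given by the matrix of operators with entries $-C_{ab}\Delta^{\alpha_{ab}}$ for $a\neq b$ and $\sum_{g}C_{ag}\Delta^{\alpha_{ag}}$ for $a=b$. In the basis formed by the wavelets in each copy, it is block diagonal with blocks of size $|G|\times|G|$. A block belonging to a wavelet $\psi_{r,n}$ is the Laplacian matrix $L_r$ of $G$ with edge weights $q^{\alpha_e(1-r)}$. The spectral polynomial $P_G^\Delta(X,Y)\in\mathbb{Z}[X,Y]$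 is the characteristic polynomial, in the variable $X$, of the Laplacian matrix of $G$ with edge weights $Y^{\alpha_e}$. The spectral curve of $(G,\Delta)$ is the projective completion of the plane curve $P_G^\Delta=0$. The spectral game: the player is allowed to choose diffusion parameters $\Delta$ once, and a prime number $p$ as many times as wished. For each $p$ the player receives the multi-set $\operatorname{Spec}(\Lambda_G^\Delta)$ of an unknown simple finite connected graph $G$. The player wins by recovering the spectral curve of the diffusion pair $(G,\Delta)$ from these spectra, and otherwise loses. *)

(* Defs.v *)
From HB Require Import structures.
From mathcomp Require Import all_boot all_order all_algebra.
From mathcomp Require Import all_classical all_reals all_analysis.
From mathcomp Require Import complex.

Set Implicit Arguments.
Unset Strict Implicit.
Unset Printing Implicit Defensive.

Import Order.TTheory GRing.Theory Num.Theory.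
Import numFieldNormedType.Exports.

Local Open Scope classical_set_scope.
Local Open Scope ring_scope.

(* A field complete with respect to a discrete non-Archimedean absolute value
   with finite residue field; [lf_abs] is the normalized absolute value, and
   [lf_card] is the cardinality q of the residue field. *)
Record localField (R : realType) := LocalField {
  lf_sort :> fieldType;
  lf_abs : lf_sort -> R;
  lf_card : nat;
  lf_abs_ge0 : forall x, 0 <= lf_abs x;
  lf_abs_eq0 : forall x, lf_abs x = 0 <-> x = 0;
  lf_absM : forall x y, lf_abs (x * y) = lf_abs x * lf_abs y;
  lf_absD : forall x y, lf_abs (x + y) <= Num.max (lf_abs x) (lf_abs y);
  lf_uniformizer : exists x, lf_abs x = lf_card%:R^-1;
  lf_discrete :
    forall x, x != 0 -> exists k : int, lf_abs x = lf_card%:R ^ k;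
  (* The [rep i] represent the residue classes, without repetition. *)
  lf_residue : exists rep : 'I_lf_card -> lf_sort,
    [/\ forall i, lf_abs (rep i) <= 1,
        forall i j, lf_abs (rep i - rep j) < 1 -> i = j
      & forall x, lf_abs x <= 1 -> exists i, lf_abs (x - rep i) < 1];
  lf_complete : forall u : nat -> lf_sort,
    (forall e : R, 0 < e -> exists N, forall m n,
       (N <= m)%N -> (N <= n)%N -> lf_abs (u m - u n) < e) ->
    exists l, forall e : R, 0 < e -> exists N, forall n,
       (N <= n)%N -> lf_abs (u n - l) < e
}.

Definition lf_open (R : realType) (K : localField R) : set (set K) :=
  [set U | forall x, U x -> exists2 e : R, 0 < e &
     forall y, lf_abs (y - x) < e -> U y].

Definition lf_pointed (R : realType) (K : localField R) : Type := K.

HB.instance Definition _ (R : realType) (K : localField R) :=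
  Choice.copy (lf_pointed K) K.
HB.instance Definition _ (R : realType) (K : localField R) :=
  isPointed.Build (lf_pointed K) (0 : K).

Definition lf_borel (R : realType) (K : localField R) :=
  g_sigma_algebraType (@lf_open R K : set (set (lf_pointed K))).

(* The data fixing the Fourier transform: the Haar measure giving the ring of
   integers O mass 1, and a unitary character of (K, +) trivial on O but not on
   any larger ball (which makes it continuous, and the measure self-dual). *)
Record fourierData (R : realType) (K : localField R) := FourierData {
  haar : {measure set (lf_borel K) -> \bar R};
  haar_shift : forall (a : K) (A : set (lf_borel K)), measurable A ->
    haar [set a + x | x in (A : set K)] = haar A;
  haar_integers : haar [set x : K | lf_abs x <= 1] = 1%E;
  lf_char : K -> R[i];
  lf_charD : forall x y, lf_char (x + y) = lf_char x * lf_char y;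
  lf_char_unitary : forall x, `|lf_char x| = 1;
  lf_char_integers : forall x, lf_abs x <= 1 -> lf_char x = 1;
  lf_char_rank0 : exists2 x, lf_abs x = (lf_card K)%:R & lf_char x <> 1
}.

Section Operators.
Variables (R : realType) (K : localField R) (W : fourierData K).
Implicit Types f g : K -> R[i].

Definition cintegral f : R[i] :=
  Complex (\int[haar W]_(x in setT) complex.Re (f x))%R
          (\int[haar W]_(x in setT) complex.Im (f x))%R.

Definition sqnormL2 f : \bar R :=
  (\int[haar W]_(x in setT) (complex.Re (f x) ^+ 2 + complex.Im (f x) ^+ 2)%:E)%E.

(* Elements of L^2(K) are represented by functions; equality in L^2(K) is
   equality almost everywhere. *)
Definition inL2 f :=
  [/\ measurable_fun (setT : set (lf_borel K)) (fun x => complex.Re (f x)),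
      measurable_fun (setT : set (lf_borel K)) (fun x => complex.Im (f x))
    & (sqnormL2 f < +oo)%E].

Definition eqL2 f g := {ae haar W, forall x, f x = g x}.

Definition cvgL2 (phi : nat -> K -> R[i]) f :=
  sqnormL2 (fun x => phi n x - f x) @[n --> \oo] --> 0%E.

(* Schwartz-Bruhat functions; a locally constant function of compact support is
   uniformly locally constant. *)
Definition schwartzBruhat f :=
  (exists2 d : R, 0 < d & forall x h, lf_abs h <= d -> f (x + h) = f x) /\
  (exists M : R, forall x, M < lf_abs x -> f x = 0).

Definition fourierSB f : K -> R[i] :=
  fun xi => cintegral (fun x => lf_char W (xi * x) * f x).

(* [isFourier f g] : g is the Fourier transform of f in L^2(K), the latter being
   the continuous extension of the Fourier transform of Schwartz-Bruhat
   functions. *)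
Definition isFourier f g :=
  [/\ inL2 f, inL2 g
    & exists phi : nat -> K -> R[i],
      [/\ forall n, schwartzBruhat (phi n),
          cvgL2 phi f & cvgL2 (fun n => fourierSB (phi n)) g]].

(* Unbounded operators, here and below, are given by their graphs:
   [isVladimirov alpha f g] says that f is in the domain of
   Delta^alpha = F^-1 |.|^alpha F, with image g. *)
Definition isVladimirov (alpha : nat) f g :=
  exists2 fhat, isFourier f fhat &
    isFourier g (fun xi => (lf_abs xi ^+ alpha)%:C%C * fhat xi).

End Operators.

Section Graphs.
Variable V : finType.

(* The unknown graph has its vertices among the elements of V, so that its order
   may be unknown as well. *)
Record graph := Graph {
  vertices : {set V};
  edge : rel V;
  edge_vertices : forall a b, edge a b -> (a \in vertices) && (b \in vertices);
  edge_sym : symmetric edge;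
  edge_irr : irreflexive edge
}.

Definition vertex (G : graph) := {a : V | a \in vertices G}.

Definition connected_graph (G : graph) :=
  vertices G != finset.set0 /\
  {in vertices G &, forall a b, connect (edge G) a b}.

(* Diffusion parameters on all the pairs of distinct elements of V, that is on
   all potential edges; the pair (G, alpha) only involves the edges of G. *)
Definition diffusion_parameters (alpha : V -> V -> nat) :=
  forall a b, a != b -> (0 < alpha a b)%N /\ alpha a b = alpha b a.

(* Repetitions are allowed in the sum, which is over a list [s] of edges other
   than the edge ab. *)
Definition no_label_is_sum (alpha : V -> V -> nat) :=
  forall (a b : V) (s : seq (V * V)), a != b ->
    (forall e, e \in s -> e.1 != e.2 /\ e != (a, b) /\ e != (b, a)) ->
    alpha a b <> (\sum_(e <- s) alpha e.1 e.2)%N.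

(* An isomorphism of graphs that also preserves the edge labels. *)
Definition isomorphic (alpha : V -> V -> nat) (G H : graph) :=
  exists2 f : vertex G -> vertex H, bijective f &
    forall a b, edge H (val (f a)) (val (f b)) = edge G (val a) (val b) /\
      (edge G (val a) (val b) ->
       alpha (val (f a)) (val (f b)) = alpha (val a) (val b)).

End Graphs.

Section Laplacian.
Variables (R : realType) (K : localField R) (W : fourierData K).
Variables (V : finType) (alpha : V -> V -> nat) (G : graph V).

(* The operator C_ab Delta^(alpha_ab), where C is the adjacency matrix. *)
Definition isWeight (a b : vertex G) (f g : K -> R[i]) :=
  if edge G (val a) (val b) then isVladimirov W (alpha (val a) (val b)) f g
  else eqL2 W g (fun=> 0).

Definition isLaplacianEntry (a b : vertex G) (f g : K -> R[i]) :=
  if a == b then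
    exists2 h : vertex G -> K -> R[i], forall c, isWeight a c f (h c) &
      eqL2 W g (fun x => \sum_c h c x)
  else exists2 h, isWeight a b f h & eqL2 W g (fun x => - h x).

Definition isLaplacian (u w : vertex G -> K -> R[i]) :=
  [/\ forall a, inL2 W (u a), forall a, inL2 W (w a)
    & exists2 h : vertex G -> vertex G -> K -> R[i],
        forall a b, isLaplacianEntry a b (u b) (h a b) &
        forall a, eqL2 W (w a) (fun x => \sum_b h a b x)].

Definition in_eigenspace (lambda : R[i]) (u : vertex G -> K -> R[i]) :=
  isLaplacian u (fun a x => lambda * u a x).

Definition freeL2 (k : nat) (u : 'I_k -> vertex G -> K -> R[i]) :=
  forall c : 'I_k -> R[i],
    (forall a, eqL2 W (fun x => \sum_i c i * u i a x) (fun=> 0)) ->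
    forall i, c i = 0.

(* The multi-set Spec, as the function mapping lambda to its multiplicity: the
   dimension, possibly infinite, of the eigenspace of lambda. *)
Definition Spec (lambda : R[i]) : \bar R :=
  ereal_sup [set k%:R%:E | k in [set k : nat |
    exists2 u : 'I_k -> vertex G -> K -> R[i],
      forall i, in_eigenspace lambda (u i) & freeL2 u]].

End Laplacian.

Definition prime_number := {p : nat | prime p}.

(* A play of the spectral game with diffusion parameters [alpha]: the player asks
   for the primes of the list [ps], which does not depend on the unknown graph G,
   and applies [rec] to the spectra obtained. *)
Definition reconstructs (R : realType)
    (K : prime_number -> localField R) (W : forall p, fourierData (K p))
    (V : finType) (alpha : V -> V -> nat)
    (ps : seq prime_number) (rec : seq (R[i] -> \bar R) -> graph V) :=
  forall G : graph V, connected_graph G ->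
    isomorphic alpha G (rec [seq Spec (W p) alpha G | p <- ps]).

(* Main.v *)
Require Import Defs.
From mathcomp Require Import all_boot all_order all_algebra.
From mathcomp Require Import all_classical all_reals all_analysis.
From mathcomp Require Import measurable_realfun complex.
From mathcomp Require Import ring lra zify.

(** A single large prime suffices.  Let L_G(t) be the Laplacian matrix of G with
    the weight t^alpha_e on each edge e.  The argument has an analytic half, which
    turns Spec into eigenvalues of the matrices L_G(t), and an algebraic half,
    which recovers G from them.

    Analysis.  The Fourier transform makes the p-adic Laplacian act, at almost
    every frequency xi, as the matrix L_G(|xi|).  Hence a nonzero lambda with
    nonzero multiplicity is an eigenvalue of L_G(q^l) for some integer l
    ([eigenvector_of_Spec]); conversely a wave whose transform lives on |xi| = q
    shows that each eigenvalue of L_G(q) occurs ([Spec_of_eigenvector]).  The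
    Fourier transform is only described as a limit of transforms of
    Schwartz-Bruhat functions, so this requires that it is well defined and
    injective on L^2, that is, Plancherel's formula.  A Schwartz-Bruhat function
    takes one value on each coset of a small ball inside a large one, so that
    its integrals are finite sums over coset representatives, and Plancherel's
    formula becomes orthogonality of characters ([plancherel_step]).

    Algebra.  A nonzero eigenvalue of a weighted Laplacian is, up to a factor
    depending only on the number of vertices, the weight of some edge
    ([eigenvalue_scale]).  If q exceeds these factors, an eigenvalue common to
    L_G(q) and L_H(q^l) gives edges e of G and f of H with alpha_e = l alpha_f.
    As no label is a sum of other labels, l = 1: the mixture of all the spectra
    of L_H(q^l) cannot hide the nonzero spectrum of L_H(q), and graphs with equal
    Spec have equal nonzero eigenvalues at q ([same_eigenvalues]).  These are
    simple.  Indeed if the eigenspace were a plane, it would contain a nonzero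
    vector equal at both ends of the edge whose weight is close to lambda; this
    vector is also an eigenvector for the graph without that edge, where no
    other weight is close to lambda ([eigenvalue_simple]).  Summing the
    eigenvalues, the traces agree, so the sums of q^alpha_e over the edges agree;
    as distinct edges have distinct labels, no label being a sum with one term,
    comparison in base q shows that the edges agree ([same_edges]).  A connected graph is determined by its edges, except that a
    graph with no edge is a single vertex, unique up to isomorphism. *)

Set Implicit Arguments.
Unset Strict Implicit.
Unset Printing Implicit Defensive.

Import Order.TTheory GRing.Theory Num.Theory.
Import numFieldNormedType.Exports.

(** * Size of the eigenvalues of a weighted Laplacian *)

Section WeightedLaplacian.
Local Open Scope ring_scope.

Definition laplacian (F : pzRingType) (T : finType) (w : T -> T -> F)
    (x : T -> F) (a : T) : F :=
  \sum_b w a b * (x a - x b).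

(** The Dirichlet energy: symmetrizing the sum over the two ends of each edge. *)
Lemma laplacian_energy (F : comPzRingType) (T : finType) (w : T -> T -> F)
    (x : T -> F) :
  (forall a b, w a b = w b a) ->
  (\sum_a x a * laplacian w x a) *+ 2
    = \sum_a \sum_b w a b * (x a - x b) ^+ 2.
Proof.
move=> wC; rewrite mulr2n.
under eq_bigr do rewrite mulr_sumr.
rewrite {2}exchange_big -big_split; apply: eq_bigr => a _ /=.
rewrite -big_split; apply: eq_bigr => b _ /=.
by rewrite (wC b a); ring.
Qed.

(** The terms with both ends in [A] cancel in pairs.  The equality is doubled so
    that it holds in every ring. *)
Lemma laplacian_sum_over (F : comPzRingType) (T : finType) (w : T -> T -> F)
    (x : T -> F) (A : pred T) :
  (forall a b, w a b = w b a) ->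
  (\sum_(a | A a) laplacian w x a) *+ 2 =
    (\sum_(a | A a) \sum_(b | ~~ A b) w a b * (x a - x b)) *+ 2.
Proof.
move=> wC.
under eq_bigr => a _ do rewrite /laplacian (bigID A) /=.
rewrite big_split /= mulrnDl [X in X + _](_ : _ = 0) ?add0r //.
rewrite mulr2n {2}exchange_big -big_split big1 //= => a _.
rewrite -big_split big1 //= => b _.
by rewrite (wC b a); ring.
Qed.

(** For the eigenvalue [lam] of a Laplacian on [n] vertices, [v] has the order of
    magnitude of [lam].  The powers of [n] are those which the estimates below
    produce. *)
Definition in_band (R : numDomainType) (n : nat) (lam v : R) :=
  v <= 8 * n%:R ^+ 3 * lam /\ lam <= 8 * n%:R ^+ 2 * v.

Section Scale.
Variables (R : realFieldType) (T : finType) (w : T -> T -> R).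
Variables (x : T -> R) (lam : R).
Hypothesis w_ge0 : forall a b, 0 <= w a b.
Hypothesis wC : forall a b, w a b = w b a.
Hypothesis eig : forall a, laplacian w x a = lam * x a.
Hypothesis lam_neq0 : lam != 0.
Variable a0 : T.
Hypothesis xa0_gt0 : 0 < x a0.
Hypothesis xa0_max : forall a, `|x a| <= x a0.

Let N : R := #|T|%:R.
Let M := x a0.

Let N_ge1 : 1 <= N.
Proof. by rewrite ler1n; apply/card_gt0P; exists a0. Qed.

Let sqr_le a : x a ^+ 2 <= M ^+ 2.
Proof. by rewrite -real_normK ?num_real// ler_sqr ?nnegrE// ltW. Qed.

Let energyE : (lam * \sum_a x a ^+ 2) *+ 2
  = \sum_a \sum_b w a b * (x a - x b) ^+ 2.
Proof.
rewrite -(laplacian_energy _ wC) mulr_sumr; congr (_ *+ 2).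
by apply: eq_bigr => a _; rewrite eig; ring.
Qed.

Let term_ge0 a b : 0 <= w a b * (x a - x b) ^+ 2.
Proof. by rewrite mulr_ge0 ?sqr_ge0. Qed.

Lemma eigenvalue_gt0 : 0 < lam.
Proof.
rewrite lt_neqAle eq_sym lam_neq0 /=.
have s_gt0 : 0 < \sum_a x a ^+ 2.
  rewrite (bigD1 a0) //= ltr_pwDl ?exprn_gt0 // sumr_ge0 // => a _.
  exact: sqr_ge0.
rewrite -(pmulr_lge0 _ s_gt0) -(pmulrn_lge0 _ (ltn0Sn 1)) energyE.
by apply: sumr_ge0 => a _; apply: sumr_ge0.
Qed.

(* Suppose that no weight is in the band: every weight is then heavy or much
   smaller than [lam].  An eigenvector cannot vary much along a heavy edge, since
   its energy is [lam] times its square norm. *)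
Let heavy a b := 8 * N ^+ 3 * lam < w a b.

Let heavy_close a b : heavy a b -> `|x a - x b| <= M / (2 * N).
Proof.
move=> hab; rewrite leNgt; apply/negP => far.
have l0 := eigenvalue_gt0.
have M0 : 0 < M by [].
have N0 : 0 < N by apply: lt_le_trans N_ge1.
have : w a b * (x a - x b) ^+ 2 <= (lam * (N * M ^+ 2)) *+ 2.
  apply: (@le_trans _ _ ((lam * \sum_a x a ^+ 2) *+ 2)).
    rewrite energyE (bigD1 a) //= (bigD1 b) //= -addrA lerDl addr_ge0 //.
      by apply: sumr_ge0.
    by apply: sumr_ge0 => c _; apply: sumr_ge0.
  rewrite lerMn2r ler_wpM2l ?(ltW l0) //.
  apply: (le_trans (ler_sum _ (fun a _ => sqr_le a))).
  by rewrite sumr_const -mulr_natl.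
apply/negP; rewrite -ltNge.
have lt2 : (M / (2 * N)) ^+ 2 < (x a - x b) ^+ 2.
  rewrite -[ltRHS]real_normK ?num_real // ltr_sqr // nnegrE ?normr_ge0 //.
  by rewrite divr_ge0 ?ltW // mulr_gt0.
have h1 : 8 * N ^+ 3 * lam * (x a - x b) ^+ 2 < w a b * (x a - x b) ^+ 2.
  by rewrite ltr_pM2r // (le_lt_trans _ lt2) // sqr_ge0.
apply: lt_trans h1.
rewrite (_ : _ *+ 2 = 8 * N ^+ 3 * lam * (M / (2 * N)) ^+ 2).
  by rewrite ltr_pM2l // !mulr_gt0 // exprn_gt0.
by field; rewrite gt_eqF.
Qed.

Let path_close (p : seq T) a : path heavy a p ->
  `|x a - x (last a p)| <= (size p)%:R * (M / (2 * N)).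
Proof.
elim: p a => [|b p IH] a /=; first by rewrite subrr normr0 mul0r.
case/andP=> /heavy_close hab /IH hb.
rewrite -natr1 mulrDl mul1r [leRHS]addrC.
have -> : x a - x (last b p) = (x a - x b) + (x b - x (last b p)) by ring.
by apply: (le_trans (ler_normD _ _)); apply: lerD.
Qed.

Let connect_close a : connect heavy a0 a -> M / 2 <= x a.
Proof.
case/connectP => p /shortenP[q hq uq _] ->.
have M0 : 0 < M by [].
have N0 : 0 < N by apply: lt_le_trans N_ge1.
have : (size q)%:R * (M / (2 * N)) <= M / 2.
  rewrite (_ : M / 2 = N * (M / (2 * N))); last by field; rewrite gt_eqF.
  rewrite ler_pM2r ?divr_gt0 ?mulr_gt0 // ler_nat.
  by have := max_card (mem (a0 :: q)); rewrite (card_uniqP uq) /= => /ltnW.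
have := path_close hq; rewrite ler_norml -/M => /andP[_ h1 h2].
by lra.
Qed.

(** On the component of [a0] for heavy edges, [x] is at least half its maximum, so
    [lam] times its sum there is large; but this is the sum of the Laplacian over
    the component, to which only the light edges leaving it contribute. *)
Lemma eigenvalue_scale_at_max :
  exists a b, in_band #|T| lam (w a b).
Proof.
have l0 := eigenvalue_gt0.
have M0 : 0 < M by [].
have N0 : 0 < N by apply: lt_le_trans N_ge1.
have [/existsP[a /existsP[b /andP[h1 h2]]]|no] := boolP [exists a, exists b,
  (w a b <= 8 * N ^+ 3 * lam) && (lam <= 8 * N ^+ 2 * w a b)].
  by exists a, b.
pose A := connect heavy a0.
have light a b : A a -> ~~ A b -> w a b * (x a - x b) <= lam * M / (4 * N ^+ 2).
  move=> Aa nAb.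
  have nh : ~~ heavy a b.
    by apply: contra nAb => hab; apply: connect_trans Aa (connect1 hab).
  have wab : w a b <= lam / (8 * N ^+ 2).
    rewrite ler_pdivlMr ?mulr_gt0 ?exprn_gt0 // mulrC ltW // ltNge.
    move: no => /existsPn/(_ a)/existsPn/(_ b); rewrite negb_and.
    by move: nh; rewrite /heavy -leNgt => -> /=.
  have dx : x a - x b <= 2 * M.
    have /ler_normlP[_ h1] := xa0_max a; have /ler_normlP[h2 _] := xa0_max b.
    by rewrite -/M in h1 h2; lra.
  rewrite (_ : lam * _ / _ = lam / (8 * N ^+ 2) * (2 * M)); last first.
    by field; rewrite gt_eqF.
  apply: (le_trans (ler_wpM2l (w_ge0 a b) dx)).
  by rewrite ler_wpM2r // mulr_ge0 // ltW.
have up : \sum_(a | A a) laplacian w x a <= lam * M / 4.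
  have -> : \sum_(a | A a) laplacian w x a
      = \sum_(a | A a) \sum_(b | ~~ A b) w a b * (x a - x b).
    apply/eqP; rewrite -(@eqr_pMn2r R 2) //.
    by rewrite (laplacian_sum_over _ A wC).
  have c0 : 0 <= lam * M / (4 * N ^+ 2).
    by rewrite divr_ge0 ?mulr_ge0 ?exprn_ge0 // ltW.
  have -> : lam * M / 4 = \sum_(a : T) \sum_(b : T) lam * M / (4 * N ^+ 2).
    rewrite !sumr_const -[X in _ = X *+ _]mulr_natl -[RHS]mulr_natl -/N.
    by field; rewrite gt_eqF.
  rewrite big_mkcond /=; apply: ler_sum => a _.
  case: ifP => [Aa|_]; last by apply: sumr_ge0.
  rewrite big_mkcond /=; apply: ler_sum => b _.
  by case: ifP => [nAb|_] //; apply: light.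
have lo : lam * M / 2 <= \sum_(a | A a) laplacian w x a.
  rewrite (bigD1 a0) /=; last exact: connect0.
  rewrite eig -/M ler_wpDr //.
    apply: sumr_ge0 => a /andP[Aa _]; rewrite eig mulr_ge0 ?(ltW l0) //.
    by apply: le_trans (connect_close Aa); rewrite divr_ge0 // ltW.
  have : 0 < lam * M by rewrite mulr_gt0.
  by lra.
have : 0 < lam * M by rewrite mulr_gt0.
by lra.
Qed.

End Scale.

(** Up to its sign, an eigenvector attains the maximum of its absolute value at a
    vertex where it is positive. *)
Lemma eigenvalue_scale (R : realFieldType) (T : finType) (w : T -> T -> R)
    (x : T -> R) (lam : R) (a : T) :
  (forall a b, 0 <= w a b) -> (forall a b, w a b = w b a) ->
  (forall a, laplacian w x a = lam * x a) -> lam != 0 -> x a != 0 ->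
  0 < lam /\ exists a b, in_band #|T| lam (w a b).
Proof.
move=> w0 wC eig l0 xa.
pose a0 := [arg max_(i > a) `|x i|]%O.
have a0_max b : `|x b| <= `|x a0|.
  by rewrite /a0; case: arg_maxP => // i _; apply.
have xa0 : x a0 != 0.
  by rewrite -normr_gt0; apply: lt_le_trans (a0_max a); rewrite normr_gt0.
pose s := Num.sg (x a0); pose y b := s * x b.
have ya0 : y a0 = `|x a0| by rewrite /y /s normrEsg.
have ny b : `|y b| = `|x b|.
  by rewrite /y normrM normr_sg xa0 mul1r.
have eigy b : laplacian w y b = lam * y b.
  rewrite /y mulrCA -eig mulr_sumr; apply: eq_bigr => c _; ring.
have ya0_gt0 : 0 < y a0 by rewrite ya0 normr_gt0.
have ya0_max b : `|y b| <= y a0 by rewrite ny ya0.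
split; first exact: (eigenvalue_gt0 w0 wC eigy l0 ya0_gt0).
exact: (eigenvalue_scale_at_max w0 wC eigy l0 ya0_gt0 ya0_max).
Qed.

End WeightedLaplacian.

(** * Simple eigenvalues and the trace *)

Section LaplacianSpectrum.
Local Open Scope ring_scope.

Definition laplacian_eigenvector (F : pzRingType) (T : finType)
    (w : T -> T -> F) (lam : F) (x : T -> F) :=
  (exists a, x a != 0) /\ forall a, laplacian w x a = lam * x a.

Variable R : rcfType.

Lemma Re_sum I (r : seq I) (P : pred I) (F : I -> R[i]) :
  complex.Re (\sum_(i <- r | P i) F i) = \sum_(i <- r | P i) complex.Re (F i).
Proof. by apply: (big_morph (@complex.Re R)) => // -[? ?] [? ?]. Qed.

Lemma Im_sum I (r : seq I) (P : pred I) (F : I -> R[i]) :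
  complex.Im (\sum_(i <- r | P i) F i) = \sum_(i <- r | P i) complex.Im (F i).
Proof. by apply: (big_morph (@complex.Im R)) => // -[? ?] [? ?]. Qed.

Lemma ReB (x y : R[i]) : complex.Re (x - y) = complex.Re x - complex.Re y.
Proof. by case: x y => [? ?] [? ?]. Qed.

Lemma ImB (x y : R[i]) : complex.Im (x - y) = complex.Im x - complex.Im y.
Proof. by case: x y => [? ?] [? ?]. Qed.

Lemma Re_realM (r : R) (x : R[i]) : complex.Re (r%:C%C * x) = r * complex.Re x.
Proof. by case: x => ? ? /=; rewrite mul0r subr0. Qed.

Lemma Im_realM (r : R) (x : R[i]) : complex.Im (r%:C%C * x) = r * complex.Im x.
Proof. by case: x => ? ? /=; rewrite mul0r addr0. Qed.

Variable T : finType.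
Implicit Types (w : T -> T -> R) (lam : R) (z : T -> R[i]).

Definition cweight w : T -> T -> R[i] := fun a b => (w a b)%:C%C.

Lemma real_eigenvector w lam z :
  laplacian_eigenvector (cweight w) lam%:C%C z ->
  exists x : T -> R, laplacian_eigenvector w lam x.
Proof.
case=> [[a za] eig].
have eRe b : laplacian w (fun a => complex.Re (z a)) b = lam * complex.Re (z b).
  rewrite -Re_realM -eig Re_sum; apply: eq_bigr => c _ /=.
  by rewrite Re_realM ReB.
have eIm b : laplacian w (fun a => complex.Im (z a)) b = lam * complex.Im (z b).
  rewrite -Im_realM -eig Im_sum; apply: eq_bigr => c _ /=.
  by rewrite Im_realM ImB.
have [r0|r0] := eqVneq (complex.Re (z a)) 0.
  exists (fun a => complex.Im (z a)); split => //; exists a.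
  apply: contra za => /eqP /= i0.
  by rewrite eq_complex r0 i0 !eqxx.
by exists (fun a => complex.Re (z a)); split => //; exists a.
Qed.

Lemma complex_eigenvector w lam (x : T -> R) :
  laplacian_eigenvector w lam x ->
  laplacian_eigenvector (cweight w) lam%:C%C (fun a => (x a)%:C%C).
Proof.
case=> [[a xa] eig]; split=> [|b].
  by exists a; apply: contra xa => /eqP[->].
rewrite -rmorphM -eig /laplacian rmorph_sum; apply: eq_bigr => c _.
by rewrite rmorphM rmorphB.
Qed.

Section Simple.
Variables (w : T -> T -> R) (lam : R).
Hypothesis w_ge0 : forall a b, 0 <= w a b.
Hypothesis wC : forall a b, w a b = w b a.
Hypothesis lam_neq0 : lam != 0.

Hypothesis one_edge_in_band : forall a b c d,
  in_band #|T| lam (w a b) -> in_band #|T| lam (w c d) ->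
  (c, d) = (a, b) \/ (c, d) = (b, a).

(** An edge along which [z] is constant does not contribute to the Laplacian of
    [z]: deleting it leaves an eigenvector of a graph with no weight in the band
    of [lam], which [eigenvalue_scale] forbids unless [z] vanishes. *)
Lemma flat_eigenvector_eq0 a b z : in_band #|T| lam (w a b) ->
  (forall c, laplacian (cweight w) z c = lam%:C%C * z c) ->
  z a = z b -> forall c, z c = 0.
Proof.
move=> hab eig zab c; apply/eqP/negPn/negP => zc.
pose w' c d := if ((c, d) == (a, b)) || ((c, d) == (b, a)) then 0 else w c d.
have [x [[e xe] eig']] : exists x, laplacian_eigenvector w' lam x.
  apply: (@real_eigenvector _ _ z); split; first by exists c.
  move=> e; rewrite -eig; apply: eq_bigr => d _; rewrite /cweight /w'.
  by case: ifP => // /orP[] /eqP[-> ->]; rewrite zab subrr !mulr0.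
have w'_ge0 u v : 0 <= w' u v by rewrite /w'; case: ifP.
have w'C u v : w' u v = w' v u.
  rewrite /w' !xpair_eqE wC.
  by rewrite (andbC (v == a)) (andbC (v == b)) orbC.
have [l0 [u [v [h1 h2]]]] := eigenvalue_scale w'_ge0 w'C eig' lam_neq0 xe.
move: h1 h2; rewrite /w'; case: ifPn => [_ _|/norP[/eqP n1 /eqP n2] h1 h2].
  by rewrite mulr0 leNgt l0.
by case: (one_edge_in_band hab (conj h1 h2)).
Qed.

(** Two eigenvectors have a nontrivial combination that is constant along the edge
    in the band; it vanishes by [flat_eigenvector_eq0]. *)
Lemma eigenvalue_simple (x y : T -> R[i]) :
  (forall a, laplacian (cweight w) x a = lam%:C%C * x a) ->
  (forall a, laplacian (cweight w) y a = lam%:C%C * y a) ->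
  exists s t : R[i], ((s != 0) || (t != 0)) /\ forall a, s * x a + t * y a = 0.
Proof.
move=> ex ey.
have [/existsP[e xe]|] := boolP [exists e, x e != 0]; last first.
  move=> /existsPn x0; exists 1, 0; split=> [|a]; first by rewrite oner_eq0.
  by rewrite mul0r addr0 mul1r; apply/eqP/negPn/x0.
have [x' [[e' xe'] eig']] := real_eigenvector (conj (ex_intro _ e xe) ex).
have [_ [a [b hab]]] := eigenvalue_scale w_ge0 wC eig' lam_neq0 xe'.
have flat s t : s * (x a - x b) + t * (y a - y b) = 0 ->
    forall c, s * x c + t * y c = 0.
  move=> st; apply: (flat_eigenvector_eq0 hab) => [c|]; last first.
    by apply/eqP; rewrite -subr_eq0 -st; apply/eqP; ring.
  rewrite mulrDr mulrCA -ex (mulrCA _ t) -ey !mulr_sumr -big_split.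
  by apply: eq_bigr => d _ /=; ring.
have [dx|dx] := eqVneq (x a - x b) 0.
  exists 1, 0; split; first by rewrite oner_eq0.
  by apply: flat; rewrite dx mulr0 mul0r addr0.
(* These coefficients make the combination constant along the edge ab. *)
exists (y a - y b), (- (x a - x b)); split; first by rewrite oppr_eq0 dx orbT.
by apply: flat; ring.
Qed.

End Simple.

Section Trace.
Variable w : T -> T -> R.
Hypothesis wC : forall a b, w a b = w b a.
Hypothesis w_diag : forall a, w a a = 0.
Hypothesis simple : forall lam (x y : T -> R[i]), lam != 0 ->
  (forall a, laplacian (cweight w) x a = lam%:C%C * x a) ->
  (forall a, laplacian (cweight w) y a = lam%:C%C * y a) ->
  exists s t : R[i], ((s != 0) || (t != 0)) /\ forall a, s * x a + t * y a = 0.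

Let n := #|T|.
Let M : 'M[R[i]]_n := \matrix_(i, j)
  (((i == j)%:R * \sum_b w (enum_val i) b)
    - w (enum_val i) (enum_val j))%:C%C.

Let mulM (v : 'rV[R[i]]_n) j :
  (v *m M) 0 j = laplacian (cweight w) (fun a => v 0 (enum_rank a)) (enum_val j).
Proof.
rewrite mxE /laplacian enum_valK.
under eq_bigr do rewrite mxE rmorphB rmorphM /= mulrBr.
rewrite big_split /= (bigD1 j) //= [X in _ + X + _ = _]big1 ?addr0 => [|i ij]; last first.
  by rewrite (negbTE ij) mul0r mulr0.
rewrite eqxx mul1r; under [RHS]eq_bigr do rewrite mulrBr.
rewrite [RHS]big_split /= -mulr_suml rmorph_sum [in LHS]mulrC; congr (_ + _).
rewrite (reindex_onto enum_rank enum_val) => [|i _]; last exact: enum_valK.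
under eq_bigl do rewrite enum_rankK eqxx.
by apply: eq_bigr => a _; rewrite enum_rankK wC mulrC.
Qed.

Let M_herm : M \is hermsymmx.
Proof.
apply: realsym_hermsym.
  apply/is_hermitianmxP; rewrite expr0 scale1r map_mx_id //.
  apply/matrixP => i j; rewrite !mxE wC eq_sym.
  by case: eqVneq => [->|_] //; rewrite !mul0r.
apply/mxOverP => i j; rewrite mxE.
by rewrite complex_real.
Qed.

Let P := spectralmx M.
Let D := spectral_diag M.

Let PM : P *m M = diag_mx D *m P.
Proof.
have /orthomx_spectralP Mdec := hermitian_normalmx M_herm.
rewrite [X in P *m X]Mdec.
by rewrite -/P -/D !mulmxA mulmxV ?mul1mx // spectral_unit.
Qed.

Let D_real i : D 0 i = (complex.Re (D 0 i))%:C%C.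
Proof.
have /mxOverP/(_ 0 i) := hermitian_spectral_diag_real M_herm.
by rewrite -/D; case: (D 0 i) => a b; rewrite complex_real => /eqP /= ->.
Qed.

Let row_eig i a :
  laplacian (cweight w) (fun a => P i (enum_rank a)) a
    = D 0 i * P i (enum_rank a).
Proof.
have := mulM (row i P) (enum_rank a).
rewrite -row_mul PM row_mul row_diag_mx -scalemxAl -rowE enum_rankK !mxE => ->.
by apply: eq_bigr => b _; rewrite !mxE.
Qed.

(** By the spectral theorem the trace is the sum of the eigenvalues, each nonzero
    one occurring once by simplicity; so it depends only on the set of nonzero
    eigenvalues. *)
Lemma trace_from_spectrum : exists s : seq R,
  [/\ uniq s,
      forall lam, lam \in s <->
        lam != 0 /\ exists x : T -> R, laplacian_eigenvector w lam x
    & \sum_(lam <- s) lam = \sum_a \sum_b w a b].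
Proof.
exists [seq complex.Re (D 0 i) | i <- index_enum 'I_n & D 0 i != 0]; split.
- rewrite map_inj_in_uniq ?filter_uniq ?index_enum_uniq //.
  move=> i j; rewrite !mem_filter => /andP[Di0 _] _ Dij.
  apply/eqP/negPn/negP => ij.
  have l0 : complex.Re (D 0 i) != 0.
    by apply: contra Di0 => /eqP e; rewrite D_real e.
  have [] := simple l0 (x := fun a => P i (enum_rank a))
                       (y := fun a => P j (enum_rank a)).
  - by move=> a; rewrite row_eig -D_real.
  - by move=> a; rewrite row_eig Dij -D_real.
  move=> s [t [st0 dep]].
  pose u : 'rV_n := s *: delta_mx 0 i + t *: delta_mx 0 j.
  have uP : u *m P = 0.
    apply/rowP => k; rewrite mulmxDl -!scalemxAl -!rowE !mxE.
    by have := dep (enum_val k); rewrite enum_valK.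
  have u0 : u = 0.
    by rewrite -(mulmxK (spectral_unit M) u) -/P uP mul0mx.
  move/rowP: u0 => u0; case/orP: st0 => /eqP; apply.
    have := u0 i; rewrite !mxE !eqxx (negbTE ij) /= mulr0 addr0 mulr1.
    by move=> ->.
  have := u0 j; rewrite !mxE !eqxx eq_sym (negbTE ij) /= mulr0 add0r mulr1.
  by move=> ->.
- move=> lam; split.
    case/mapP => i; rewrite mem_filter => /andP[Di0 _] ->.
    split; first by apply: contra Di0 => /eqP e; rewrite D_real e.
    apply: (@real_eigenvector _ _ (fun a => P i (enum_rank a))); split.
      have [/existsP[a Pa]|] := boolP [exists a, P i (enum_rank a) != 0].
        by exists a.
      move=> /existsPn Pi0; exfalso.
      have : delta_mx 0 i *m P = 0 :> 'rV_n.
        apply/rowP => k; rewrite -rowE !mxE.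
        by have := Pi0 (enum_val k); rewrite enum_valK negbK => /eqP.
      move=> /(congr1 (fun v => v *m invmx P)).
      rewrite mulmxK ?spectral_unit // mul0mx => /rowP/(_ i)/eqP.
      by rewrite !mxE !eqxx oner_eq0.
    by move=> a; rewrite -D_real row_eig.
  case=> l0 [x /complex_eigenvector [[a xa] eig]].
  pose v : 'rV[R[i]]_n := \row_i (x (enum_val i))%:C%C.
  have vM : v *m M = lam%:C%C *: v.
    apply/rowP => j; rewrite mulM !mxE -eig.
    by apply: eq_bigr => b _; rewrite !mxE !enum_rankK.
  have [u uP] : exists u : 'rV_n, u *m P = v.
    by exists (v *m invmx P); rewrite mulmxKV // spectral_unit.
  have uD : u *m diag_mx D = lam%:C%C *: u.
    have uDP : u *m diag_mx D *m P = lam%:C%C *: v.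
      by rewrite -mulmxA -PM mulmxA uP vM.
    rewrite -[LHS](mulmxK (spectral_unit M)) -/P uDP -uP scalemxAl.
    by rewrite mulmxK ?spectral_unit.
  have [/existsP[i ui]|] := boolP [exists i, u 0 i != 0]; last first.
    move=> /existsPn u0; case/eqP: xa.
    have e0 : u = 0.
      by apply/rowP => k; rewrite [RHS]mxE; apply/eqP/negPn; apply: u0.
    move: uP; rewrite e0 mul0mx => /rowP/(_ (enum_rank a)).
    by rewrite !mxE enum_rankK => <-.
  have Di : D 0 i = lam%:C%C.
    apply: (mulIf ui); move/rowP/(_ i): uD.
    by rewrite mul_mx_diag !mxE mulrC.
  apply/mapP; exists i; last by rewrite Di.
  rewrite mem_filter mem_index_enum andbT Di.
  by apply: contra l0 => /eqP[->].
- rewrite big_map big_filter /=.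
  have -> : \sum_(i | D 0 i != 0) complex.Re (D 0 i)
      = \sum_i complex.Re (D 0 i).
    rewrite [RHS](bigID (fun i => D 0 i != 0)) /= [X in _ = _ + X]big1 ?addr0 //.
    by move=> i /negPn/eqP ->.
  rewrite -Re_sum.
  have -> : \sum_i D 0 i = \tr M.
    rewrite -mxtrace_diag -[X in \tr X](mulmxK (spectral_unit M)) -/P -PM.
    by rewrite -mulmxA mxtrace_mulC -mulmxA mulVmx ?mulmx1 ?spectral_unit.
  rewrite Re_sum (reindex_onto enum_rank enum_val) => [|i _]; last first.
    exact: enum_valK.
  under eq_bigl do rewrite enum_rankK eqxx.
  by apply: eq_bigr => a _; rewrite mxE eqxx /= enum_rankK w_diag mul1r subr0.
Qed.

End Trace.
End LaplacianSpectrum.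

(** * Balls and cosets in a local field *)

Section LocalField.
Local Open Scope ring_scope.
Variables (R : realType) (K : localField R).
Hypothesis q_gt1 : (1 < lf_card K)%N.
Implicit Types (x y : K) (k m : int).

Local Notation q := ((lf_card K)%:R : R).
Local Notation abs := (@lf_abs R K).

Lemma residue_card_gt1 : 1 < q. Proof. by rewrite ltr1n. Qed.
Let q_gt0 : 0 < q := lt_trans ltr01 residue_card_gt1.
Let qk_gt0 k : 0 < q ^ k := exprz_gt0 k q_gt0.

Lemma lf_abs0 : abs 0 = 0. Proof. exact/lf_abs_eq0. Qed.

Lemma lf_abs1 : abs 1 = 1.
Proof.
have n0 : abs 1 != 0 by apply/eqP => /lf_abs_eq0 /eqP; rewrite oner_eq0.
by apply: (mulfI n0); rewrite -lf_absM !mulr1.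
Qed.

Lemma lf_absN x : abs (- x) = abs x.
Proof.
suff h : abs (-1) = 1 by rewrite -mulN1r lf_absM h mul1r.
have := lf_abs_ge0 (-1 : K).
have : abs (-1) * abs (-1) = 1 by rewrite -lf_absM mulrNN mulr1 lf_abs1.
by nra.
Qed.

Lemma lf_abs_le_add (r : R) x y : abs x <= r -> abs y <= r -> abs (x + y) <= r.
Proof. by move=> hx hy; apply: le_trans (lf_absD x y) _; rewrite ge_max hx. Qed.

Lemma lf_abs_le_sub (r : R) x y : abs x <= r -> abs y <= r -> abs (x - y) <= r.
Proof. by move=> hx hy; rewrite lf_abs_le_add // lf_absN. Qed.

Lemma lf_absV x : abs x^-1 = (abs x)^-1.
Proof.
have [->|x0] := eqVneq x 0; first by rewrite invr0 lf_abs0 invr0.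
have n0 : abs x != 0 by apply/eqP => /lf_abs_eq0 /eqP; rewrite (negbTE x0).
by apply: (mulfI n0); rewrite -lf_absM !mulfV // lf_abs1.
Qed.

Lemma lf_abs_surj k : exists x, abs x = q ^ k.
Proof.
have [t ht] := lf_uniformizer K.
have hX n : abs (t ^+ n) = q ^- n.
  elim: n => [|n IH]; first by rewrite expr0 invr1 lf_abs1.
  by rewrite exprS lf_absM ht IH -invfM -exprS.
by case: k => n; [exists (t ^- n) | exists (t ^+ n.+1)];
  rewrite ?lf_absV hX ?invrK.
Qed.

Lemma lf_abs_lt k x : abs x < q ^ k -> abs x <= q ^ (k - 1).
Proof.
have [->|x0] := eqVneq x 0; first by rewrite lf_abs0 ltW // qk_gt0.
have [m ->] := lf_discrete x0.
by rewrite ltr_eXz2l ?residue_card_gt1 // ler_eXz2l ?residue_card_gt1 // lerBrDr lezD1.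
Qed.

Definition coset_reps (k m : int) (I : finType) (r : I -> K) :=
  [/\ forall i, abs (r i) <= q ^ k,
      forall i j, abs (r i - r j) <= q ^ m -> i = j
    & forall x, abs x <= q ^ k -> exists i, abs (x - r i) <= q ^ m].

Lemma coset_reps_shift k m (I : finType) (r : I -> K) h :
  coset_reps k m r -> abs h <= q ^ k -> coset_reps k m (fun i => r i + h).
Proof.
case=> h1 h2 h3 hh; split=> [i|i j|x hx].
- exact: lf_abs_le_add.
- by rewrite (_ : r i + h - (r j + h) = r i - r j); [exact: h2|ring].
- have [i hi] := h3 _ (lf_abs_le_sub hx hh); exists i.
  by rewrite (_ : x - (r i + h) = x - h - r i); last ring.
Qed.

(** Each step refines the cosets of a ball by a scaled copy of the residue field. *)
Lemma coset_reps_exist k (n : nat) : exists (I : finType) (r : I -> K),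
  coset_reps k (k - n%:Z) r /\ #|I| = (lf_card K ^ n)%N.
Proof.
elim: n => [|n [I [r [[h1 h2 h3] cI]]]].
  exists unit, (fun=> 0); split; last by rewrite card_unit expn0.
  split=> [_|[] []//|x hx]; first by rewrite lf_abs0 ltW.
  by exists tt; rewrite !subr0.
have [rep [g1 g2 g3]] := lf_residue K.
have [t ht] := lf_abs_surj (k - n%:Z).
have t0 : t != 0.
  by apply: contraTneq (qk_gt0 (k - n%:Z)) => t0; rewrite -ht t0 lf_abs0 ltxx.
have qS : q ^ (k - n.+1%:Z) = q ^ (k - n%:Z) * q^-1.
  by rewrite -exprN1 -expfzDr ?gt_eqF //; congr (q ^ _); rewrite intS; ring.
exists (I * 'I_(lf_card K))%type, (fun p => r p.1 + t * rep p.2).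
split; last by rewrite card_prod cI card_ord expnSr.
have hm : q ^ (k - n%:Z) <= q ^ k.
  by rewrite ler_eXz2l ?residue_card_gt1 // lerBlDr lerDl.
have ht1 j : abs (t * rep j) <= q ^ (k - n%:Z).
  by rewrite lf_absM ht ler_piMr // ltW.
split=> [[i j]|[i j] [i' j'] /=|x hx] /=.
- by apply: lf_abs_le_add => //; apply: le_trans (ht1 j) hm.
- move=> h.
  have ii' : i = i'.
    apply: h2.
    have -> : r i - r i' = (r i + t * rep j - (r i' + t * rep j'))
                            - (t * rep j - t * rep j') by ring.
    apply: lf_abs_le_sub; last exact: lf_abs_le_sub.
    by apply: le_trans h _; rewrite qS ler_piMr ?ltW // invf_lt1 // residue_card_gt1.
  rewrite -ii' in h *; congr pair; apply: g2.
  have e : r i + t * rep j - (r i + t * rep j') = t * (rep j - rep j') by ring.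
  move: h; rewrite e lf_absM ht qS ler_pM2l // => h.
  by apply: le_lt_trans h _; rewrite invf_lt1 // residue_card_gt1.
- have [i hi] := h3 x hx.
  have [|j hj] := g3 ((x - r i) / t).
    by rewrite lf_absM lf_absV ht ler_pdivrMr ?mul1r.
  exists (i, j) => /=.
  have -> : x - (r i + t * rep j) = t * ((x - r i) / t - rep j) by field.
  rewrite lf_absM ht qS ler_pM2l // -exprN1.
  by have := @lf_abs_lt 0 _ hj; rewrite sub0r.
Qed.

End LocalField.

(** * Haar integrals of step functions *)

Section StepFunctions.
Local Open Scope classical_set_scope.
Local Open Scope ring_scope.
Variables (R : realType) (K : localField R) (W : fourierData K).
Hypothesis q_gt1 : (1 < lf_card K)%N.
Implicit Types (x y : K) (k m : int).

Local Notation q := ((lf_card K)%:R : R).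
Local Notation abs := (@lf_abs R K).
Local Notation mu := (haar W).

Let q_gt0 : 0 < q := lt_trans ltr01 (residue_card_gt1 q_gt1).
Let qk_gt0 k : 0 < q ^ k := exprz_gt0 k q_gt0.

Definition cball (a : K) (m : int) : set (lf_borel K) :=
  [set x : K | abs (x - a) <= q ^ m].

Lemma measurable_cball a m : measurable (cball a m).
Proof.
apply: sub_sigma_algebra => x /= hx; exists (q ^ m) => // y hy.
rewrite /cball /= (_ : y - a = (y - x) + (x - a)); last ring.
by apply: lf_abs_le_add => //; apply: ltW.
Qed.

Lemma haar_cball_center a m : mu (cball a m) = mu (cball 0 m).
Proof.
rewrite -(haar_shift W a (measurable_cball 0 m)); congr (mu _).
apply/seteqP; split => x /=.
  by move=> hx; exists (x - a); rewrite /cball /= ?subr0 ?subrKC.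
by case=> y + <-; rewrite /cball /= subr0 addrC addKr.
Qed.

(** The Schwartz-Bruhat functions, with explicit radii: q^m for the scale on which
    the function is constant, q^k for its support. *)
Definition step_function (E : zmodType) (k m : int) (f : K -> E) :=
  (forall x h, abs h <= q ^ m -> f (x + h) = f x) /\
  (forall x, q ^ k < abs x -> f x = 0).

Lemma step_function_expand (k m : int) (I : finType) (r : I -> K)
    (f : K -> R) : m <= k -> coset_reps k m r -> step_function k m f ->
  forall x, f x = \sum_i f (r i) * \1_(cball (r i) m) x.
Proof.
move=> mk [r1 r2 r3] [f1 f2] x.
have [hx|hx] := leP (abs x) (q ^ k); last first.
  rewrite f2 // big1 // => i _; rewrite indicE memNset ?mulr0 //.
  rewrite /cball /= => h; move: hx; rewrite ltNge => /negP; apply.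
  rewrite (_ : x = (x - r i) + r i); last by rewrite subrK.
  apply: lf_abs_le_add => //; apply: le_trans h _.
  by rewrite ler_eXz2l // residue_card_gt1.
have [i hi] := r3 x hx.
rewrite (bigD1 i) //= big1 => [|j ji]; last first.
  rewrite indicE memNset ?mulr0 // /cball /= => hj.
  case/eqP: ji; apply: r2.
  rewrite (_ : r j - r i = (x - r i) - (x - r j)); last ring.
  exact: lf_abs_le_sub.
rewrite indicE mem_set ?mulr1 ?addr0 //.
by rewrite -[in LHS](subrKC (r i) x) f1.
Qed.

Lemma measurable_step (k m : int) (f : K -> R) :
  m <= k -> step_function k m f -> measurable_fun (setT : set (lf_borel K)) f.
Proof.
move=> mk sf.
have [n kn] : exists n : nat, m = k - n%:Z.
  by exists `|k - m|%N; rewrite gez0_abs ?subr_ge0 // subKr.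
have [I [r [hr _]]] := coset_reps_exist q_gt1 k n; rewrite -kn in hr.
rewrite (funext (step_function_expand mk hr sf)).
apply: measurable_sum => i; apply: measurable_funM => //.
by apply: measurable_indic; apply: measurable_cball.
Qed.

(** The indicator of the large ball is the sum of the indicators of the cosets,
    which all have the same measure by translation invariance. *)
Lemma haar_cball_split (k m : int) (I : finType) (r : I -> K) :
  m <= k -> coset_reps k m r ->
  mu (cball 0 k) = ((#|I|%:R)%:E * mu (cball 0 m))%E.
Proof.
move=> mk hr.
have sf : step_function k m (\1_(cball 0 k) : K -> R).
  have mkq : q ^ m <= q ^ k by rewrite ler_eXz2l // residue_card_gt1.
  split=> [x h hh|x hx]; rewrite !indicE; last first.
    by rewrite memNset // /cball /= subr0 => h; move: hx; rewrite ltNge h.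
  congr ((_ : bool)%:R); apply/idP/idP; rewrite !inE /cball /= !subr0 => hx.
    rewrite -(addrK h x) lf_abs_le_sub // (le_trans hh) //.
  by rewrite lf_abs_le_add // (le_trans hh).
rewrite -[X in mu X](setIT (cball 0 k)) -integral_indic //; last apply: measurable_cball.
have e x : (\1_(cball 0 k) x)%:E = \sum_(i : I) (\1_(cball (r i) m) x)%:E :> \bar R.
  rewrite (step_function_expand mk hr sf) sumEFin; congr _%:E.
  apply: eq_bigr => i _; rewrite [X in X * _]indicE mem_set ?mul1r //.
  by rewrite /cball /= subr0; case: hr.
under eq_integral do rewrite e.
have m1 i : measurable_fun (setT : set (lf_borel K))
    (fun x => (\1_(cball (r i) m) x)%:E : \bar R).
  by apply/measurable_EFinP; apply: measurable_indic; apply: measurable_cball.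
rewrite ge0_integral_sum //.
under eq_bigr => i _.
  rewrite integral_indic ?setIT //; last apply: measurable_cball.
  rewrite haar_cball_center; over.
rewrite sumr_const /= -[LHS]/(mu (cball 0 m) *+ #|I|)%E.
by rewrite mule_natl.
Qed.

(** The ring of integers is split into cosets when [m] is negative, and is itself
    a coset in the ball when [m] is nonnegative. *)
Lemma haar_cball a m : mu (cball a m) = (q ^ m)%:E.
Proof.
rewrite haar_cball_center.
have c0 : mu (cball 0 0) = 1%E.
  rewrite -(haar_integers W); congr (mu _).
  by apply/seteqP; split=> x; rewrite /cball /= subr0 expr0z.
case: m => n.
  have [I [r [hr cI]]] := coset_reps_exist q_gt1 n n.
  rewrite subrr in hr.
  by rewrite (haar_cball_split _ hr) // c0 mule1 cI natrX.
have [I [r [hr cI]]] := coset_reps_exist q_gt1 0 n.+1.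
rewrite sub0r -NegzE in hr.
have := haar_cball_split _ hr; rewrite c0 => /(_ isT).
rewrite cI natrX.
have qn0 : q ^+ n.+1 != 0 by rewrite gt_eqF // exprn_gt0.
case: (mu (cball 0 (Negz n))) => [v|//|] /=.
- rewrite -EFinM => -[h]; congr _%:E.
  by apply: (mulfI qn0); rewrite -h NegzE -exprnN mulfV.
- by rewrite gt0_muley // lte_fin exprn_gt0.
- by rewrite gt0_muleNy // lte_fin exprn_gt0.
Qed.

Lemma integral_step (k m : int) (I : finType) (r : I -> K) (f : K -> R) :
  m <= k -> coset_reps k m r -> step_function k m f ->
  (\int[mu]_(x in setT) (f x)%:E = (q ^ m * \sum_i f (r i))%:E)%E.
Proof.
move=> mk hr sf.
have e x : (f x)%:E = (\sum_(i : I) (f (r i))%:E * (\1_(cball (r i) m) x)%:E)%E.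
  by rewrite (step_function_expand mk hr sf) -sumEFin.
under eq_integral do rewrite e.
have int1 i : mu.-integrable setT (fun x => (\1_(cball (r i) m) x)%:E).
  apply/integrableP; split.
    by apply/measurable_EFinP; apply: measurable_indic; apply: measurable_cball.
  under eq_integral do rewrite gee0_abs ?lee_fin //.
  rewrite integral_indic //; last apply: measurable_cball.
  by rewrite setIT haar_cball ltry.
rewrite integral_sum // => [|i]; last exact: integrableZl.
under eq_bigr => i _.
  rewrite integralZl // integral_indic ?setIT //; last apply: measurable_cball.
  rewrite haar_cball -EFinM; over.
by rewrite sumEFin /= -mulr_suml mulrC.
Qed.

End StepFunctions.

(** * Plancherel formula for step functions *)

Section Plancherel.
Local Open Scope classical_set_scope.
Local Open Scope ring_scope.

Definition sqrc (R : realType) (z : R[i]) : R :=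
  complex.Re z ^+ 2 + complex.Im z ^+ 2.

Lemma sqrcE (R : realType) (z : R[i]) : (sqrc z)%:C%C = `|z| ^+ 2.
Proof.
by case: z => a b /=; rewrite -rmorphXn sqr_sqrtr // addr_ge0 ?sqr_ge0.
Qed.

Lemma conjC_realc (R : realType) (c : R) : (c%:C%C)^* = c%:C%C :> R[i].
Proof. exact: conjc_real. Qed.

Variables (R : realType) (K : localField R) (W : fourierData K).
Hypothesis q_gt1 : (1 < lf_card K)%N.
Implicit Types (x y xi : K) (k m : int) (f phi : K -> R[i]).

Local Notation q := ((lf_card K)%:R : R).
Local Notation abs := (@lf_abs R K).
Local Notation mu := (haar W).
Local Notation chi := (@lf_char R K W).

Let q_gt0 : 0 < q := lt_trans ltr01 (residue_card_gt1 q_gt1).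
Let qk_gt0 k : 0 < q ^ k := exprz_gt0 k q_gt0.
Let qC_neq0 k : (q ^ k)%:C%C != 0 :> R[i].
Proof. by apply/eqP => -[h]; have := qk_gt0 k; rewrite h ltxx. Qed.

Lemma complexRM (c : R) (z : R[i]) :
  Complex (c * complex.Re z) (c * complex.Im z) = c%:C%C * z.
Proof. by case: z => a b /=; rewrite -[RHS]/(Complex _ _) !mul0r subr0 addr0. Qed.

Lemma step_function_comp (E F : zmodType) (u : E -> F) k m (f : K -> E) :
  u 0 = 0 -> step_function k m f -> step_function k m (u \o f).
Proof.
move=> u0 [f1 f2]; split=> [x h hh|x hx] /=; first by rewrite f1.
by rewrite f2.
Qed.

Lemma step_function_widen (E : zmodType) k m k' m' (f : K -> E) :
  k <= k' -> m' <= m -> step_function k m f -> step_function k' m' f.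
Proof.
move=> kk mm [f1 f2]; split=> x.
  move=> h hh; apply/f1/(le_trans hh).
  by rewrite ler_eXz2l // residue_card_gt1.
move=> hx; apply/f2/le_lt_trans/hx.
by rewrite ler_eXz2l // residue_card_gt1.
Qed.

Lemma coset_reps_ex k m : m <= k ->
  exists (I : finType) (r : I -> K), coset_reps k m r.
Proof.
move=> mk; have [I [r [h _]]] := coset_reps_exist q_gt1 k `|k - m|%N.
by exists I, r; rewrite gez0_abs ?subr_ge0 // subKr in h.
Qed.

Lemma measurable_step_Re k m f : m <= k -> step_function k m f ->
  measurable_fun (setT : set (lf_borel K)) (fun x => complex.Re (f x)).
Proof.
move=> mk sf.
exact: (measurable_step q_gt1 mk (step_function_comp (u := @complex.Re R) erefl sf)).
Qed.

Lemma measurable_step_Im k m f : m <= k -> step_function k m f ->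
  measurable_fun (setT : set (lf_borel K)) (fun x => complex.Im (f x)).
Proof.
move=> mk sf.
exact: (measurable_step q_gt1 mk (step_function_comp (u := @complex.Im R) erefl sf)).
Qed.

Section Steps.
Variables (k m : int) (I : finType) (r : I -> K).
Hypotheses (mk : m <= k) (hr : coset_reps k m r).

Lemma cintegral_step f : step_function k m f ->
  cintegral W f = (q ^ m)%:C%C * \sum_i f (r i).
Proof.
move=> sf; rewrite /cintegral /Rintegral.
have sR := step_function_comp (u := @complex.Re R) erefl sf.
have sI := step_function_comp (u := @complex.Im R) erefl sf.
rewrite (integral_step W q_gt1 mk hr sR) (integral_step W q_gt1 mk hr sI) /=.
by rewrite -Re_sum -Im_sum complexRM.
Qed.

Lemma sqnormL2_step f : step_function k m f ->
  sqnormL2 W f = (q ^ m * \sum_i sqrc (f (r i)))%:E.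
Proof.
move=> sf.
have u0 : sqrc (0 : R[i]) = 0 by rewrite /sqrc /= expr0n addr0.
by rewrite /sqnormL2 (integral_step W q_gt1 mk hr (step_function_comp u0 sf)).
Qed.

Lemma card_coset_reps : #|I|%:R = q ^ (k - m) :> R.
Proof.
have := haar_cball_split W q_gt1 mk hr; rewrite !haar_cball // -EFinM => -[h].
apply: (mulIf (lt0r_neq0 (qk_gt0 m))); rewrite -h -expfzDr ?gt_eqF //.
by rewrite subrK.
Qed.

(** The translates of the representatives are representatives as well, and both
    sums compute the integral of [f]; so the sum is equal to [c] times itself. *)
Lemma step_sum_eq0 f h (c : R[i]) : step_function k m f -> abs h <= q ^ k ->
  (forall x, f (x + h) = c * f x) -> c != 1 -> \sum_i f (r i) = 0.
Proof.
move=> sf hh fh c1.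
have e : \sum_i f (r i) = \sum_i f (r i + h).
  apply: (mulfI (qC_neq0 m)); rewrite -cintegral_step //.
  rewrite /cintegral /Rintegral.
  have sR := step_function_comp (u := @complex.Re R) erefl sf.
  have sI := step_function_comp (u := @complex.Im R) erefl sf.
  have hr' := coset_reps_shift hr hh.
  rewrite (integral_step W q_gt1 mk hr' sR) (integral_step W q_gt1 mk hr' sI) /=.
  by rewrite -Re_sum -Im_sum complexRM.
move: e; under [RHS]eq_bigr do rewrite fh.
rewrite -mulr_sumr => e; apply/eqP.
have : (c - 1) * \sum_i f (r i) = 0 by rewrite mulrBl -e mul1r subrr.
by move/eqP; rewrite mulf_eq0 subr_eq0 (negbTE c1).
Qed.

End Steps.

Lemma lf_char0 : chi 0 = 1.
Proof. by apply: lf_char_integers; rewrite lf_abs0. Qed.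

Lemma lf_charN x : chi (- x) = (chi x)^*.
Proof.
have n1 : chi x * (chi x)^* = 1 by rewrite -normCK lf_char_unitary expr1n.
have c0 : chi x != 0 by rewrite -normr_eq0 lf_char_unitary oner_eq0.
by apply: (mulfI c0); rewrite n1 -lf_charD subrr lf_char0.
Qed.

Lemma lf_char_local k xi h : abs xi <= q ^ (- k) -> abs h <= q ^ k ->
  chi (xi * h) = 1.
Proof.
move=> h1 h2; apply: lf_char_integers; rewrite lf_absM.
apply: (@le_trans _ _ (q ^ (- k) * q ^ k)).
  by rewrite ler_pM ?lf_abs_ge0.
by rewrite -expfzDr ?gt_eqF // addNr expr0z.
Qed.

(** A multiple of the element of absolute value q where the character is
    nontrivial. *)
Lemma lf_char_nontrivial k xi : q ^ (- k) < abs xi ->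
  exists2 h, abs h <= q ^ k & chi (xi * h) <> 1.
Proof.
move=> hxi; have [y hy chiy] := lf_char_rank0 W.
have x0 : xi != 0.
  by apply: contraTneq hxi => ->; rewrite lf_abs0 -leNgt ltW.
have [l hl] := lf_discrete x0.
exists (y / xi); last by rewrite mulrCA mulfV // mulr1.
rewrite lf_absM lf_absV hy hl ler_pdivrMr // -{1}(expr1z q) -expfzDr ?gt_eqF //.
move: hxi; rewrite hl ltr_eXz2l ?ler_eXz2l ?residue_card_gt1 // -lezD1 => hkl.
by lia.
Qed.


Lemma step_function_char k m xi phi : abs xi <= q ^ (- m) ->
  step_function k m phi -> step_function k m (fun x => chi (xi * x) * phi x).
Proof.
move=> hxi [p1 p2]; split=> [x h hh|x hx]; last by rewrite p2 ?mulr0.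
by rewrite mulrDr lf_charD (lf_char_local hxi hh) mulr1 p1.
Qed.

(** At a frequency |xi| <= q^(-m) the integrand is still constant on balls of
    radius q^m.  At a higher frequency it is multiplied by a nontrivial constant
    under a translation preserving [phi], so its integral vanishes. *)
Lemma fourierSB_step k m (I : finType) (r : I -> K) phi xi :
  m <= k -> coset_reps k m r -> step_function k m phi ->
  fourierSB W phi xi =
    if abs xi <= q ^ (- m) then (q ^ m)%:C%C * \sum_i chi (xi * r i) * phi (r i)
    else 0.
Proof.
move=> mk hr sp; rewrite /fourierSB; case: leP => hxi.
  by rewrite (cintegral_step mk hr (step_function_char hxi sp)).
have [h hh chih] := lf_char_nontrivial hxi.
have x0 : xi != 0.
  by apply: contraTneq hxi => ->; rewrite lf_abs0 -leNgt ltW.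
(* With |xi| = q^l, the integrand is constant on balls of radius q^(-l). *)
have [l hl] := lf_discrete x0.
have lm : - l < m.
  by move: hxi; rewrite hl ltr_eXz2l ?residue_card_gt1 // ltrNl.
have lk : - l <= k by apply: le_trans mk; apply: ltW.
have sp' := step_function_widen (lexx k) (ltW lm) sp.
have hx : abs xi <= q ^ (- (- l)) by rewrite opprK hl.
have [J [s hs]] := coset_reps_ex lk.
rewrite (cintegral_step lk hs (step_function_char hx sp')).
rewrite (step_sum_eq0 lk hs (step_function_char hx sp') (h := h) (c := chi (xi * h))).
- by rewrite mulr0.
- by apply: le_trans hh _; rewrite ler_eXz2l // residue_card_gt1.
- by move=> x; rewrite mulrDr lf_charD; case: sp => -> // _; ring.
- exact/eqP.
Qed.

(** For x in the support, chi (xi * x) does not change when xi moves by at most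
    q^(-k). *)
Lemma step_function_fourier k m phi : m <= k -> step_function k m phi ->
  step_function (- m) (- k) (fourierSB W phi).
Proof.
move=> mk sp; have [I [r hr]] := coset_reps_ex mk.
have F := fourierSB_step _ mk hr sp.
split=> [xi h hh|xi hxi]; last by rewrite F leNgt hxi.
have hm : abs h <= q ^ (- m).
  by apply: le_trans hh _; rewrite ler_eXz2l ?residue_card_gt1 // lerN2.
rewrite !F; congr (if _ then _ else _).
  apply/idP/idP => hx; last exact: lf_abs_le_add.
  by rewrite -(addrK h xi) lf_abs_le_sub.
congr (_ * _); apply: eq_bigr => i _; congr (_ * _).
by rewrite mulrDl lf_charD (lf_char_local hh) ?mulr1 //; case: hr.
Qed.

Lemma char_sum_eq0 k m (J : finType) (s : J -> K) b : m <= k ->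
  coset_reps (- m) (- k) s -> q ^ m < abs b -> abs b <= q ^ k ->
  \sum_j chi (s j * b) = 0.
Proof.
move=> mk hs hb1 hb2; have mk' : - k <= - m by rewrite lerN2.
pose f xi : R[i] := if abs xi <= q ^ (- m) then chi (xi * b) else 0.
have -> : \sum_j chi (s j * b) = \sum_j f (s j).
  by apply: eq_bigr => j _; rewrite /f; case: hs => ->.
have ball xi h : abs h <= q ^ (- m) ->
    (abs (xi + h) <= q ^ (- m)) = (abs xi <= q ^ (- m)).
  move=> hh; apply/idP/idP => hx; last exact: lf_abs_le_add.
  by rewrite -(addrK h xi) lf_abs_le_sub.
have [h hh chih] : exists2 h, abs h <= q ^ (- m) & chi (b * h) <> 1.
  by apply: lf_char_nontrivial; rewrite opprK.
apply: (step_sum_eq0 mk' hs (h := h) (c := chi (b * h))) => //.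
- split=> [xi e he|xi hxi]; last by rewrite /f leNgt hxi.
  have he' : abs e <= q ^ (- m).
    by apply: le_trans he _; rewrite ler_eXz2l // residue_card_gt1.
  rewrite /f ball //; case: ifP => // _.
  rewrite mulrDl lf_charD (lf_char_local he) ?mulr1 //.
- move=> xi; rewrite /f ball //; case: ifP => _; last by rewrite mulr0.
  by rewrite mulrDl lf_charD mulrC [h * b]mulrC.
- exact/eqP.
Qed.

(** Expanding the square norm of the transform gives a double sum over
    representatives i, i', in which the sum over frequencies of the character at
    r i - r i' kills the terms with i <> i'. *)
Lemma plancherel_step k m phi : m <= k -> step_function k m phi ->
  sqnormL2 W (fourierSB W phi) = sqnormL2 W phi.
Proof.
move=> mk sp; have mk' : - k <= - m by rewrite lerN2.
have [I [r hr]] := coset_reps_ex mk; have [J [s hs]] := coset_reps_ex mk'.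
rewrite (sqnormL2_step mk hr sp).
rewrite (sqnormL2_step mk' hs (step_function_fourier mk sp)); congr _%:E.
apply: (@complexI R); rewrite !rmorphM !rmorph_sum /=.
have hm : (q ^ m)%:C%C * ((q ^ (- k))%:C%C * #|J|%:R) = 1 :> R[i].
  have -> : #|J|%:R = (q ^ (- m - - k))%:C%C :> R[i].
    by rewrite -(card_coset_reps mk' hs) rmorph_nat.
  rewrite -!rmorphM -!expfzDr ?gt_eqF //.
  by rewrite (_ : m + (- k + (- m - - k)) = 0) ?expr0z //; ring.
have expand j : (sqrc (fourierSB W phi (s j)))%:C%C = (q ^ m)%:C%C ^+ 2 *
    \sum_i \sum_i' phi (r i) * (phi (r i'))^* * chi (s j * (r i - r i')).
  rewrite sqrcE normCK (fourierSB_step _ mk hr sp); case: hs => -> _ _.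
  rewrite rmorphM /= conjC_realc rmorph_sum /= mulrACA -expr2; congr (_ * _).
  rewrite mulr_suml; apply: eq_bigr => i _; rewrite mulr_sumr.
  apply: eq_bigr => i' _; rewrite rmorphM /= mulrBr lf_charD lf_charN.
  by rewrite mulrACA [X in _ = X]mulrC.
under eq_bigr do rewrite expand.
rewrite -mulr_sumr exchange_big /= mulrCA !mulr_sumr; apply: eq_bigr => i _.
rewrite exchange_big /= (bigD1 i) //= [X in _ + X]big1 => [|i' ii'].
  rewrite addr0 sqrcE normCK.
  under eq_bigr do rewrite subrr mulr0 lf_char0 mulr1.
  rewrite sumr_const -[_ *+ #|_|]mulr_natr expr2.
  transitivity ((q ^ m)%:C%C * (phi (r i) * (phi (r i))^*)
      * ((q ^ m)%:C%C * ((q ^ (- k))%:C%C * #|J|%:R))); first by ring.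
  by rewrite hm mulr1.
rewrite -mulr_sumr (char_sum_eq0 mk hs) ?mulr0 //.
  rewrite ltNge; apply: contraNN ii' => h; apply/eqP/esym.
  by case: hr => _ r2 _; apply: r2.
by apply: lf_abs_le_sub; case: hr.
Qed.

Lemma archimedean_exprz (x : R) : exists k : int, x <= q ^ k.
Proof.
have [n hn] : exists n : nat, x <= n%:R.
  exists (Num.bound `|x|); apply: ltW.
  exact: le_lt_trans (ler_norm x) (archi_boundP (normr_ge0 x)).
exists n%:Z; apply: (le_trans hn); rewrite -exprnP -natrX ler_nat ltnW //.
exact: ltn_expl.
Qed.

Lemma schwartzBruhat_step phi : schwartzBruhat phi <->
  exists k m, m <= k /\ step_function k m phi.
Proof.
split=> [[[d d0 p1] [M p2]]|[k [m [mk [p1 p2]]]]].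
  have [k hk] := archimedean_exprz M; have [m hm] := archimedean_exprz d^-1.
  exists (Num.max k (- m)), (- m); split; first by rewrite le_max lexx orbT.
  apply: (@step_function_widen _ k (- m)); rewrite ?le_max ?lexx //; split.
    move=> x h hh; apply: p1; apply: le_trans hh _.
    by rewrite -invr_expz invf_ple // posrE.
  by move=> x hx; apply: p2; apply: le_lt_trans hk hx.
split; first by exists (q ^ m).
by exists (q ^ k).
Qed.

End Plancherel.

(** * The Fourier transform on square-integrable functions *)

Section FourierL2.
Local Open Scope classical_set_scope.
Local Open Scope ring_scope.
Variables (R : realType) (K : localField R) (W : fourierData K).
Hypothesis q_gt1 : (1 < lf_card K)%N.
Implicit Types (f g phi : K -> R[i]) (c : R[i]).

Local Notation mu := (haar W).

Section AlmostEverywhere.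
Implicit Types P Q : K -> Prop.

(** Almost everywhere, for predicates on [K]: the measure lives on [lf_borel K],
    which unification does not identify with [K]. *)
Definition ae P := {ae mu, forall x, P x}.
Let FF : Filter (almost_everywhere (mu)) := ae_filter_ringOfSetsType (mu).

Lemma aeT P : (forall x, P x) -> ae P.
Proof. by move=> h; apply: (@filterS _ _ FF setT P _ filterT) => x _; apply: h. Qed.

Lemma ae_impl P Q : (forall x, P x -> Q x) -> ae P -> ae Q.
Proof. exact: (@filterS _ _ FF P Q). Qed.

Lemma ae_impl2 P P' Q : (forall x, P x -> P' x -> Q x) -> ae P -> ae P' -> ae Q.
Proof. exact: (@filterS2 _ _ FF P P' Q). Qed.

Lemma ae_forall (I : finType) (P : I -> K -> Prop) :
  (forall i, ae (P i)) -> ae (fun x => forall i, P i x).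
Proof. exact: (@filter_forall _ I P _ FF). Qed.

End AlmostEverywhere.

Definition measurableC f :=
  measurable_fun (setT : set (lf_borel K)) (fun x => complex.Re (f x)) /\
  measurable_fun (setT : set (lf_borel K)) (fun x => complex.Im (f x)).

Lemma measurableC_add f g : measurableC f -> measurableC g ->
  measurableC (fun x => f x + g x).
Proof.
case=> f1 f2 [g1 g2]; split.
  rewrite (_ : (fun x => _) =
      (fun x => complex.Re (f x)) \+ (fun x => complex.Re (g x))).
    exact: measurable_funD.
  by apply/funext => x /=; case: (f x) (g x) => [? ?] [? ?].
rewrite (_ : (fun x => _) =
    (fun x => complex.Im (f x)) \+ (fun x => complex.Im (g x))).
  exact: measurable_funD.
by apply/funext => x /=; case: (f x) (g x) => [? ?] [? ?].
Qed.

Lemma measurableC_scale c f : measurableC f -> measurableC (fun x => c * f x).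
Proof.
case=> f1 f2; split.
  rewrite (_ : (fun x => _) = (cst (complex.Re c) \* (fun x => complex.Re (f x)))
      \- (cst (complex.Im c) \* (fun x => complex.Im (f x)))).
    by apply: measurable_funB; apply: measurable_funM.
  by apply/funext => x /=; case: c (f x) => [? ?] [? ?].
rewrite (_ : (fun x => _) = (cst (complex.Re c) \* (fun x => complex.Im (f x)))
    \+ (cst (complex.Im c) \* (fun x => complex.Re (f x)))).
  by apply: measurable_funD; apply: measurable_funM.
by apply/funext => x /=; case: c (f x) => [? ?] [? ?].
Qed.

Lemma measurable_sqrc f : measurableC f ->
  measurable_fun (setT : set (lf_borel K)) (fun x => (sqrc (f x))%:E : \bar R).
Proof.
by case=> f1 f2; apply/measurable_EFinP; apply: measurable_funD; apply: measurable_funX.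
Qed.

Lemma sqrc_ge0 c : 0 <= sqrc c.
Proof. by rewrite addr_ge0 ?sqr_ge0. Qed.

Lemma sqrc0 : sqrc 0 = 0 :> R.
Proof. by rewrite /sqrc /= expr0n addr0. Qed.

Lemma sqrc_eq0 c : sqrc c = 0 -> c = 0.
Proof.
move=> /(congr1 (fun x => x%:C%C)) /eqP; rewrite sqrcE.
by rewrite sqrf_eq0 normr_eq0 => /eqP.
Qed.

Lemma sqrcM c d : sqrc (c * d) = sqrc c * sqrc d :> R.
Proof. by apply: (@complexI R); rewrite /= rmorphM /= !sqrcE normrM exprMn. Qed.

Lemma sqrc_add c d : sqrc (c + d) <= 2 * sqrc c + 2 * sqrc d.
Proof.
case: c d => [a b] [c d]; rewrite /sqrc /=.
have := sqr_ge0 (a - c); have := sqr_ge0 (b - d); nra.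
Qed.

Lemma sqnormL2_ge0 f : (0 <= sqnormL2 W f)%E.
Proof. by apply: integral_ge0 => x _; rewrite lee_fin sqrc_ge0. Qed.

Lemma sqnormL2_scale c f : measurableC f ->
  sqnormL2 W (fun x => c * f x) = ((sqrc c)%:E * sqnormL2 W f)%E.
Proof.
move=> mf; rewrite /sqnormL2.
have -> : (\int[mu]_(x in setT) (sqrc (c * f x)%R)%:E
    = \int[mu]_(x in setT) ((sqrc c)%:E * (sqrc (f x))%:E)%E)%E.
  by apply: eq_integral => x _; rewrite sqrcM EFinM.
rewrite ge0_integralZl //; first exact: measurable_sqrc.
  by move=> x _; rewrite lee_fin sqrc_ge0.
by rewrite lee_fin sqrc_ge0.
Qed.

Lemma sqnormL2_add f g : measurableC f -> measurableC g ->
  (sqnormL2 W (fun x => f x + g x)%R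
    <= 2%:E * sqnormL2 W f + 2%:E * sqnormL2 W g)%E.
Proof.
move=> mf mg.
have m2 h : measurableC h -> measurable_fun (setT : set (lf_borel K))
    (fun x => (2%:E * (sqrc (h x))%:E)%E : \bar R).
  by move=> mh; apply: measurable_funeM; apply: measurable_sqrc.
have p2 (h : K -> R[i]) (x : K) : (0 <= 2%:E * (sqrc (h x))%:E :> \bar R)%E.
  by rewrite -EFinM lee_fin mulr_ge0 // sqrc_ge0.
have Z h : measurableC h ->
    (2%:E * sqnormL2 W h = \int[mu]_(x in setT) (2%:E * (sqrc (h x))%:E))%E.
  move=> mh; rewrite ge0_integralZl //; first exact: measurable_sqrc.
  by move=> x _; rewrite lee_fin sqrc_ge0.
rewrite !Z // -ge0_integralD //; [|exact: m2..].
apply: ge0_le_integral => //.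
- by move=> x _; rewrite lee_fin sqrc_ge0.
- exact: (measurable_sqrc (measurableC_add mf mg)).
- by apply: emeasurable_funD; apply: m2.
- by move=> x _; rewrite -!EFinM -EFinD lee_fin sqrc_add.
Qed.

Lemma sqnormL2_eq0 f : measurableC f ->
  sqnormL2 W f = 0%E <-> eqL2 W f (fun=> 0).
Proof.
move=> mf; have := ae_eq_integral_abs mu measurableT (measurable_sqrc mf).
have -> : (\int[mu]_(x in setT) `|(sqrc (f x))%:E|)%E = sqnormL2 W f.
  by apply: eq_integral => x _; rewrite gee0_abs // lee_fin sqrc_ge0.
move=> ->; split.
  by apply: ae_impl => x /(_ I) [] /sqrc_eq0.
by apply: ae_impl => x -> _; exact: (congr1 EFin sqrc0).
Qed.

Lemma inL2P f : inL2 W f <-> measurableC f /\ (sqnormL2 W f < +oo)%E.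
Proof. by split=> [[? ? ?]|[[? ?] ?]]; split. Qed.

Lemma inL2_scale c f : inL2 W f -> inL2 W (fun x => c * f x).
Proof.
move=> /inL2P[mf ff]; apply/inL2P; split; first exact: measurableC_scale.
rewrite sqnormL2_scale // lte_mul_pinfty // lee_fin; exact: sqrc_ge0.
Qed.

Lemma inL2_add f g : inL2 W f -> inL2 W g -> inL2 W (fun x => f x + g x).
Proof.
move=> /inL2P[mf ff] /inL2P[mg fg]; apply/inL2P; split.
  exact: measurableC_add.
apply: le_lt_trans (sqnormL2_add mf mg) _.
by rewrite lte_add_pinfty // lte_mul_pinfty // lee_fin.
Qed.

Lemma schwartzBruhat_inL2 phi : schwartzBruhat phi -> inL2 W phi.
Proof.
move=> /(schwartzBruhat_step q_gt1) [k [m [mk sp]]].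
have [I [r hr]] := coset_reps_ex q_gt1 mk.
split; [exact: measurable_step_Re sp|exact: measurable_step_Im sp|].
by rewrite (sqnormL2_step W q_gt1 mk hr sp) ltry.
Qed.

Lemma schwartzBruhat_measurable phi : schwartzBruhat phi -> measurableC phi.
Proof. by case/schwartzBruhat_inL2. Qed.

Lemma plancherel_schwartzBruhat phi : schwartzBruhat phi ->
  schwartzBruhat (fourierSB W phi) /\
  sqnormL2 W (fourierSB W phi) = sqnormL2 W phi.
Proof.
move=> /(schwartzBruhat_step q_gt1) [k [m [mk sp]]]; split.
  apply/(schwartzBruhat_step q_gt1); exists (- m), (- k).
  by rewrite lerN2; split=> //; apply: step_function_fourier.
exact: plancherel_step sp.
Qed.

Lemma schwartzBruhat_lin c phi psi : schwartzBruhat phi -> schwartzBruhat psi ->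
  schwartzBruhat (fun x => c * phi x + psi x) /\
  forall xi, fourierSB W (fun x => c * phi x + psi x) xi
    = c * fourierSB W phi xi + fourierSB W psi xi.
Proof.
move=> /(schwartzBruhat_step q_gt1) [k [m [mk sp]]].
move=> /(schwartzBruhat_step q_gt1) [k' [m' [mk' sp']]].
have mk2 : Num.min m m' <= Num.max k k'.
  by rewrite le_max ge_min mk.
have sp2 : step_function (Num.max k k') (Num.min m m') phi.
  by apply: (step_function_widen q_gt1) sp; rewrite ?le_max ?ge_min lexx.
have sp2' : step_function (Num.max k k') (Num.min m m') psi.
  by apply: (step_function_widen q_gt1) sp'; rewrite ?le_max ?ge_min lexx orbT.
have sl : step_function (Num.max k k') (Num.min m m')
    (fun x => c * phi x + psi x).
  case: sp2 sp2' => a1 a2 [b1 b2]; split=> [x h hh|x hx].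
    by rewrite a1 ?b1.
  by rewrite a2 ?b2 // mulr0 addr0.
split=> [|xi].
  by apply/(schwartzBruhat_step q_gt1); exists (Num.max k k'), (Num.min m m').
have [I [r hr]] := coset_reps_ex q_gt1 mk2.
rewrite !(fourierSB_step W q_gt1 _ mk2 hr) //; case: ifP => _; last first.
  by rewrite mulr0 addr0.
rewrite mulrCA -mulrDr; congr (_ * _); rewrite mulr_sumr -big_split.
by apply: eq_bigr => i _ /=; ring.
Qed.

Lemma cvgL2_lin c (u v : nat -> K -> R[i]) f g :
  (forall n, measurableC (u n)) -> (forall n, measurableC (v n)) ->
  measurableC f -> measurableC g ->
  cvgL2 W u f -> cvgL2 W v g ->
  cvgL2 W (fun n x => c * u n x + v n x) (fun x => c * f x + g x).
Proof.
move=> mu_ mv mf mg uf vg.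
have mB h h' : measurableC h -> measurableC h' ->
    measurableC (fun x => h x - h' x).
  move=> mh mh'; rewrite (_ : (fun x => _) = (fun x => h x + (-1) * h' x)).
    by apply: measurableC_add => //; apply: measurableC_scale.
  by apply/funext => x; rewrite mulN1r.
apply: (@squeeze_cvge _ _ _ _ (cst 0%E) _ (fun n =>
    (2%:E * ((sqrc c)%:E * sqnormL2 W (fun x => (u n x - f x)%R))
   + 2%:E * sqnormL2 W (fun x => (v n x - g x)%R))%E)).
- apply: nearW => n; rewrite sqnormL2_ge0 /=.
  rewrite -sqnormL2_scale; last exact: mB.
  rewrite (_ : (fun x => _) = (fun x => c * (u n x - f x) + (v n x - g x))).
    by apply: sqnormL2_add; [apply: measurableC_scale|]; apply: mB.
  by apply/funext => x; ring.
- exact: cvg_cst.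
- have -> : 0%E = (2%:E * ((sqrc c)%:E * 0) + 2%:E * 0)%E :> \bar R.
    by rewrite !mule0 adde0.
  apply: cvgeD; first by rewrite !mule0.
    by apply: cvgeZl => //; apply: cvgeZl.
  by apply: cvgeZl.
Qed.

Lemma isFourier_lin c f g f' g' : isFourier W f g -> isFourier W f' g' ->
  isFourier W (fun x => c * f x + f' x) (fun x => c * g x + g' x).
Proof.
move=> [f2 g2 [phi [p1 p2 p3]]] [f2' g2' [psi [s1 s2 s3]]].
have [mf mg mf' mg'] : [/\ measurableC f, measurableC g, measurableC f'
    & measurableC g'].
  by case/inL2P: f2; case/inL2P: g2; case/inL2P: f2'; case/inL2P: g2'.
split; [exact/inL2_add/f2'/inL2_scale|exact/inL2_add/g2'/inL2_scale|].
exists (fun n x => c * phi n x + psi n x); split=> [n||].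
- by case: (schwartzBruhat_lin c (p1 n) (s1 n)).
- by apply: cvgL2_lin => // n; apply: schwartzBruhat_measurable.
- rewrite (_ : (fun n => _) =
      (fun n x => c * fourierSB W (phi n) x + fourierSB W (psi n) x)).
    apply: cvgL2_lin => // n; apply: schwartzBruhat_measurable.
      by case: (plancherel_schwartzBruhat (p1 n)).
    by case: (plancherel_schwartzBruhat (s1 n)).
  apply/funext => n; apply/funext => x.
  by case: (schwartzBruhat_lin c (p1 n) (s1 n)) => _ ->.
Qed.

Lemma isFourier_schwartzBruhat phi : schwartzBruhat phi ->
  isFourier W phi (fourierSB W phi).
Proof.
move=> sp; have [sF _] := plancherel_schwartzBruhat sp.
split; [exact: schwartzBruhat_inL2|exact: schwartzBruhat_inL2|].
have z (h : K -> R[i]) : cvgL2 W (fun=> h) h.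
  rewrite /cvgL2 (_ : (fun n => _) = cst 0%E); first exact: cvg_cst.
  apply/funext => n; rewrite /sqnormL2 integral0_eq // => x _.
  by rewrite subrr /= expr0n addr0.
by exists (fun=> phi); split.
Qed.

Lemma isFourier0 : isFourier W (fun=> 0) (fun=> 0).
Proof.
have s0 : schwartzBruhat (fun _ : K => 0 : R[i]) by split; [exists 1|exists 0].
have h := isFourier_schwartzBruhat s0.
have := isFourier_lin (-1) h h.
rewrite (_ : (fun x => _) = (fun=> 0)).
  rewrite (_ : (fun x => _ + _) = (fun=> 0)) //.
  by apply/funext => x; rewrite mulN1r addNr.
by apply/funext => x; rewrite mulr0 addr0.
Qed.

Lemma isFourier_scale c f g : isFourier W f g ->
  isFourier W (fun x => c * f x) (fun x => c * g x).
Proof.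
move=> fg; have e (h : K -> R[i]) : (fun x => c * h x) = (fun x => c * h x + 0).
  by apply/funext => x; rewrite addr0.
by rewrite (e f) (e g); apply: isFourier_lin isFourier0.
Qed.

(** The limit is null exactly when the norms tend to 0, so that nullity passes
    through the isometry of Plancherel. *)
Lemma cvgL2_null (u : nat -> K -> R[i]) f :
  (forall n, measurableC (u n)) -> measurableC f -> cvgL2 W u f ->
  eqL2 W f (fun=> 0) <-> sqnormL2 W (u n) @[n --> \oo] --> 0%E.
Proof.
move=> mu_ mf uf; rewrite -(sqnormL2_eq0 mf).
have mB h h' : measurableC h -> measurableC h' ->
    measurableC (fun x => h x - h' x).
  move=> mh mh'; rewrite (_ : (fun x => _) = (fun x => h x + (-1) * h' x)).
    by apply: measurableC_add => //; apply: measurableC_scale.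
  by apply/funext => x; rewrite mulN1r.
split=> [f0|u0].
  apply: (@squeeze_cvge _ _ _ _ (cst 0%E) _ (fun n =>
    (2%:E * sqnormL2 W (fun x => u n x - f x)%R)%E)).
  - apply: nearW => n; rewrite sqnormL2_ge0 /=.
    rewrite (_ : u n = (fun x => (u n x - f x) + f x)); last first.
      by apply/funext => x; rewrite subrK.
    apply: le_trans (sqnormL2_add (mB _ _ (mu_ n) mf) mf) _.
    rewrite f0 mule0 adde0.
    by under [X in (_ <= _ * sqnormL2 _ X)%E]eq_fun do rewrite subrK.
  - exact: cvg_cst.
  - have -> : 0%E = (2%:E * 0)%E :> \bar R by rewrite mule0.
    exact: cvgeZl.
have c0 : (2%:E * sqnormL2 W (u n) +
    2%:E * sqnormL2 W (fun x => u n x - f x)%R)%E @[n --> \oo] --> 0%E.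
  have -> : 0%E = (2%:E * 0 + 2%:E * 0)%E :> \bar R.
    by rewrite !mule0 adde0.
  by apply: cvgeD; [rewrite !mule0|apply: cvgeZl..].
apply/eqP; rewrite eq_le sqnormL2_ge0 andbT.
apply: cvge_ge c0; apply: nearW => n.
rewrite [X in (sqnormL2 W X <= _)%E](_ : f = (fun x => u n x + (-1) * (u n x - f x))).
  have mm := mB _ _ (mu_ n) mf.
  apply: le_trans (sqnormL2_add (mu_ n) (measurableC_scale (-1) mm)) _.
  rewrite sqnormL2_scale // (_ : sqrc (-1) = 1) ?mul1e //.
  by rewrite /sqrc /= oppr0 sqrrN expr1n expr0n addr0.
by apply/funext => x; ring.
Qed.

(** By linearity this gives both the uniqueness of the Fourier transform and its
    injectivity. *)
Lemma isFourier_null f g : isFourier W f g ->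
  eqL2 W f (fun=> 0) <-> eqL2 W g (fun=> 0).
Proof.
move=> [/inL2P[mf _] /inL2P[mg _] [phi [p1 p2 p3]]].
have mp n := schwartzBruhat_measurable (p1 n).
have mF n : measurableC (fourierSB W (phi n)).
  by apply: schwartzBruhat_measurable; case: (plancherel_schwartzBruhat (p1 n)).
rewrite (cvgL2_null mp mf p2) (cvgL2_null mF mg p3).
have -> : (fun n => sqnormL2 W (fourierSB W (phi n)))
    = (fun n => sqnormL2 W (phi n)) => //.
by apply/funext => n; case: (plancherel_schwartzBruhat (p1 n)).
Qed.

(** Fourier pairs up to equality almost everywhere.  A function equal almost
    everywhere to a measurable one need not be Borel measurable, so [isFourier]
    itself is not stable under such changes. *)
Definition fourierAE f g := exists f' g',
  [/\ eqL2 W f f', eqL2 W g g' & isFourier W f' g'].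

Lemma eqL2_refl f : eqL2 W f f. Proof. by apply: aeT. Qed.

Lemma eqL2_sym f g : eqL2 W f g -> eqL2 W g f.
Proof. by apply: ae_impl => x ->. Qed.

Lemma eqL2_trans g f h : eqL2 W f g -> eqL2 W g h -> eqL2 W f h.
Proof. by apply: ae_impl2 => x -> ->. Qed.

Lemma isFourier_AE f g : isFourier W f g -> fourierAE f g.
Proof. by move=> h; exists f, g; split=> //; apply: eqL2_refl. Qed.

Lemma fourierAE_eq f f' g g' : eqL2 W f f' -> eqL2 W g g' ->
  fourierAE f' g' -> fourierAE f g.
Proof.
move=> ff gg [f1 [g1 [h1 h2 h3]]]; exists f1, g1; split=> //.
  exact: eqL2_trans h1.
exact: eqL2_trans h2.
Qed.

Lemma fourierAE_lin c f g f' g' : fourierAE f g -> fourierAE f' g' ->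
  fourierAE (fun x => c * f x + f' x) (fun x => c * g x + g' x).
Proof.
move=> [f1 [g1 [a1 a2 a3]]] [f2 [g2 [b1 b2 b3]]].
exists (fun x => c * f1 x + f2 x), (fun x => c * g1 x + g2 x).
split; last exact: isFourier_lin.
  by apply: ae_impl2 a1 b1 => x -> ->.
by apply: ae_impl2 a2 b2 => x -> ->.
Qed.

Lemma fourierAE_scale c f g : fourierAE f g ->
  fourierAE (fun x => c * f x) (fun x => c * g x).
Proof.
move=> [f1 [g1 [a1 a2 a3]]]; exists (fun x => c * f1 x), (fun x => c * g1 x).
split; last exact: isFourier_scale.
  by apply: ae_impl a1 => x ->.
by apply: ae_impl a2 => x ->.
Qed.

Lemma fourierAE_sum (I : finType) (f g : I -> K -> R[i]) :
  (forall i, fourierAE (f i) (g i)) ->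
  fourierAE (fun x => \sum_i f i x) (fun x => \sum_i g i x).
Proof.
move=> h; elim: (index_enum I) => [|i s IH].
  apply: (fourierAE_eq _ _ (isFourier_AE isFourier0)).
    by apply: aeT => x; rewrite big_nil.
  by apply: aeT => x; rewrite big_nil.
apply: (fourierAE_eq _ _ (fourierAE_lin 1 (h i) IH)).
  by apply: aeT => x; rewrite big_cons mul1r.
by apply: aeT => x; rewrite big_cons mul1r.
Qed.

Lemma fourierAE_null f g : fourierAE f g ->
  eqL2 W f (fun=> 0) <-> eqL2 W g (fun=> 0).
Proof.
move=> [f1 [g1 [a1 a2 /isFourier_null h]]]; split=> h0.
  by apply: (eqL2_trans a2); apply/h; apply: eqL2_trans h0; apply: eqL2_sym.
by apply: (eqL2_trans a1); apply/h; apply: eqL2_trans h0; apply: eqL2_sym.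
Qed.

Lemma fourierAE_unique f g g' : fourierAE f g -> fourierAE f g' -> eqL2 W g g'.
Proof.
move=> h h'; have /fourierAE_null[/(_ _) h1 _] := fourierAE_lin (-1) h h'.
have /h1 : eqL2 W (fun x => -1 * f x + f x) (fun=> 0).
  by apply: aeT => x; rewrite mulN1r addNr.
by apply: ae_impl => x; rewrite mulN1r addrC => /eqP; rewrite subr_eq0 => /eqP ->.
Qed.

End FourierL2.

(** * Spectrum of the p-adic Laplacian *)

Section SpecEigenvalues.
Local Open Scope classical_set_scope.
Local Open Scope ring_scope.
Variables (R : realType) (K : localField R) (W : fourierData K).
Hypothesis q_gt1 : (1 < lf_card K)%N.
Variables (V : finType) (alpha : V -> V -> nat) (G : graph V).

Local Notation q := ((lf_card K)%:R : R).
Local Notation abs := (@lf_abs R K).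

Definition edge_weight (t : R) (a b : vertex G) : R :=
  if edge G (val a) (val b) then t ^+ alpha (val a) (val b) else 0.


Lemma edge_weightT t (a b : vertex G) : edge G (val a) (val b) ->
  edge_weight t a b = t ^+ alpha (val a) (val b).
Proof. by rewrite /edge_weight => ->. Qed.

Lemma edge_weightF t (a b : vertex G) : ~~ edge G (val a) (val b) ->
  edge_weight t a b = 0.
Proof. by rewrite /edge_weight => /negbTE ->. Qed.

Lemma isWeightE (a b : vertex G) f g : isWeight W alpha a b f g =
  if edge G (val a) (val b) then isVladimirov W (alpha (val a) (val b)) f g
  else eqL2 W g (fun=> 0).
Proof. by []. Qed.

(** On the Fourier side the operator is multiplication by a function of |xi|. *)
Lemma isWeight_fourier (a b : vertex G) f g fhat :
  fourierAE W f fhat -> isWeight W alpha a b f g ->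
  fourierAE W g (fun xi => (edge_weight (abs xi) a b)%:C%C * fhat xi).
Proof.
rewrite isWeightE /edge_weight => hf; case: ifP => _.
  move=> [fh h1 h2].
  apply: fourierAE_eq (isFourier_AE h2); first exact: eqL2_refl.
  have h := fourierAE_unique q_gt1 hf (isFourier_AE h1).
  by apply: ae_impl h => x ->.
move=> g0; apply: fourierAE_eq (isFourier_AE (isFourier0 W q_gt1)) => //.
by apply: aeT => x; rewrite mul0r.
Qed.

Lemma isWeight_domain (a b : vertex G) f g :
  edge G (val a) (val b) -> isWeight W alpha a b f g ->
  exists fhat, fourierAE W f fhat.
Proof. by rewrite isWeightE => -> [fh h1 _]; exists fh; apply: isFourier_AE. Qed.

Lemma isLaplacianEntry_fourier (a b : vertex G) f g fhat :
  fourierAE W f fhat -> isLaplacianEntry W alpha a b f g ->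
  fourierAE W g (fun xi => (if a == b
    then \sum_c (edge_weight (abs xi) a c)%:C%C * fhat xi
    else - ((edge_weight (abs xi) a b)%:C%C * fhat xi))).
Proof.
move=> hf; rewrite /isLaplacianEntry; case: eqP => _ [h hw hg].
  apply: fourierAE_eq hg (eqL2_refl _ _) (fourierAE_sum q_gt1 _) => c.
  exact: isWeight_fourier (hw c).
have := fourierAE_scale q_gt1 (-1) (isWeight_fourier hf hw).
apply: fourierAE_eq.
  by apply: ae_impl hg => x ->; rewrite mulN1r.
by apply: aeT => x; rewrite mulN1r.
Qed.

Lemma isLaplacianEntry_domain (a b : vertex G) f g :
  edge G (val b) (val a) -> isLaplacianEntry W alpha b b f g ->
  exists fhat, fourierAE W f fhat.
Proof.
move=> e; rewrite /isLaplacianEntry eqxx => -[h /(_ a) hw _].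
exact: isWeight_domain hw.
Qed.

(** At an isolated vertex the operators put no condition on the functions, which
    need not be given with a Fourier transform; but the row of the Laplacian is
    then zero. *)
Lemma isLaplacianEntry_isolated (a b : vertex G) f g :
  (forall c : vertex G, ~~ edge G (val a) (val c)) ->
  isLaplacianEntry W alpha a b f g -> eqL2 W g (fun=> 0).
Proof.
move=> iso; rewrite /isLaplacianEntry; case: eqP => _ [h hw hg].
  have h0 c : eqL2 W (h c) (fun=> 0).
    by have := hw c; rewrite isWeightE (negbTE (iso c)).
  by apply: ae_impl2 hg (ae_forall h0) => x -> hx; rewrite big1.
move: hw; rewrite isWeightE (negbTE (iso b)) => h0.
by apply: ae_impl2 hg h0 => x -> ->; rewrite oppr0.
Qed.

Lemma edge_weight_diag t a : edge_weight t a a = 0.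
Proof. by rewrite /edge_weight edge_irr. Qed.

Lemma laplacian_entries t (z : vertex G -> R[i]) a :
  \sum_b (if a == b then \sum_c (edge_weight t a c)%:C%C * z b
          else - ((edge_weight t a b)%:C%C * z b))
    = laplacian (cweight (edge_weight t)) z a.
Proof.
rewrite (bigD1 a) //= eqxx /laplacian.
under [RHS]eq_bigr do rewrite mulrBr.
rewrite [RHS]big_split; congr (_ + _).
rewrite [RHS](bigD1 a) //= /cweight edge_weight_diag mul0r oppr0 add0r.
by apply: eq_bigr => b; rewrite eq_sym => /negbTE ->.
Qed.

Lemma Spec_eq0 lam :
  (forall u, in_eigenspace W alpha lam u ->
     forall a : vertex G, eqL2 W (u a) (fun=> 0)) ->
  Spec W alpha G lam = 0%E.
Proof.
move=> noeig; rewrite /Spec.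
rewrite (_ : [set _ | _ in _] = [set 0%E]) ?ereal_sup1 //.
apply/seteqP; split=> v /=; last first.
  move=> ->; exists 0%N => //=.
  exists (fun=> fun=> fun=> 0); first by case.
  by move=> c _ [].
case=> -[|k] /=; first by move=> _ <-.
case=> u ueig ufree _; exfalso.
pose c (i : 'I_k.+1) : R[i] := (i == ord0)%:R.
have /eqP : c ord0 = 0.
  apply: ufree => a; apply: ae_impl (noeig _ (ueig ord0) a) => x u0.
  rewrite (bigD1 ord0) //= u0 mulr0 add0r big1 // => i i0.
  by rewrite /c (negbTE i0) mul0r.
by rewrite /c eqxx oner_eq0.
Qed.

(** An eigenfunction has a Fourier transform which is, at almost every frequency
    xi, killed by L_G(|xi|) - lam.  By injectivity it is not almost everywhere
    zero, so it provides an eigenvector at some frequency. *)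
Lemma eigenvector_of_Spec lam :
  lam != 0 -> Spec W alpha G lam != 0%E ->
  exists (xi : K) (z : vertex G -> R[i]),
    laplacian_eigenvector (cweight (edge_weight (abs xi))) lam z.
Proof.
move=> lam0; apply: contra_neqP => noeig; apply: Spec_eq0 => u [_ _ [h h1 h2]].
have /choice [uhat hu] : forall b, exists g, fourierAE W (u b) g.
  move=> b; have [/existsP[c bc]|] :=
      boolP [exists c : vertex G, edge G (val b) (val c)].
    exact: (isLaplacianEntry_domain bc (h1 b b)).
  (* An isolated vertex: lam * u b = 0 almost everywhere, and lam is nonzero. *)
  move=> /existsPn iso; exists (fun=> 0).
  apply: fourierAE_eq (isFourier_AE (isFourier0 W q_gt1)); last exact: eqL2_refl.
  have h0 c := isLaplacianEntry_isolated iso (h1 b c).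
  apply: ae_impl2 (h2 b) (ae_forall h0) => x e hx; apply: (mulfI lam0).
  by rewrite e mulr0 big1.
have eqs a : eqL2 W (fun xi => lam * uhat a xi) (fun xi =>
    laplacian (cweight (edge_weight (abs xi))) (fun b => uhat b xi) a).
  have h3 : fourierAE W (fun x => lam * u a x) (fun xi =>
      laplacian (cweight (edge_weight (abs xi))) (fun b => uhat b xi) a).
    have := fourierAE_sum q_gt1 (fun b => isLaplacianEntry_fourier (hu b) (h1 a b)).
    apply: fourierAE_eq; first exact: h2.
    by apply: aeT => xi; rewrite laplacian_entries.
  exact: (fourierAE_unique q_gt1 (fourierAE_scale q_gt1 lam (hu a)) h3).
move=> a; apply/(fourierAE_null q_gt1 (hu a)).
apply: ae_impl (ae_forall eqs) => xi eqxi.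
apply/eqP/negPn/negP => ne0; apply: noeig.
exists xi, (fun b => uhat b xi); split; first by exists a.
by move=> b; rewrite -eqxi.
Qed.

(** The indicator of the ring of integers is its own Fourier transform; multiplied
    by the character x -> chi(a x) with |a| = q, it has its transform supported on
    the translate by -a of the ring of integers, where |xi| = |a|. *)
Lemma schwartzBruhat_on_sphere : exists psi : K -> R[i],
  [/\ schwartzBruhat psi, ~ eqL2 W psi (fun=> 0)
    & forall xi, fourierSB W psi xi != 0 -> abs xi = q].
Proof.
have q_gt1R : 1 < q := residue_card_gt1 q_gt1.
have [a ha] := lf_abs_surj K 1; rewrite expr1z in ha.
pose psi0 (x : K) : R[i] := if abs x <= 1 then 1 else 0.
have ball (x h : K) : abs h <= 1 -> (abs (x + h) <= 1) = (abs x <= 1).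
  move=> hh; apply/idP/idP => hx; last exact: lf_abs_le_add.
  by rewrite -(addrK h x) lf_abs_le_sub.
have s0 : step_function 0 0 psi0.
  split=> [x h|x]; rewrite expr0z => hh; first by rewrite /psi0 ball.
  by rewrite /psi0 leNgt hh.
pose psi x := lf_char W (a * x) * psi0 x.
have sp : step_function 0 (-1) psi.
  apply: step_function_char => //; first by rewrite ha opprK expr1z.
  exact: (step_function_widen q_gt1) s0.
have sb : schwartzBruhat psi.
  by apply/(schwartzBruhat_step q_gt1); exists 0, (-1).
exists psi; split=> //.
  move=> psi0ae; have [mpsi _] := (inL2P W psi).1 (schwartzBruhat_inL2 W q_gt1 sb).
  have /eqP := (sqnormL2_eq0 W mpsi).2 psi0ae.
  have [I [r hr]] := coset_reps_ex q_gt1 (isT : (-1 : int) <= 0).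
  rewrite (sqnormL2_step W q_gt1 _ hr sp) // eqe mulf_eq0.
  rewrite gt_eqF ?exprz_gt0 ?(lt_trans ltr01) //=.
  rewrite psumr_eq0 => [|i _]; last exact: sqrc_ge0.
  case: hr => r1 _ r3; have [|i _] := r3 0; first by rewrite lf_abs0 expr0z.
  move=> /allP/(_ i (mem_index_enum _)) /=.
  rewrite /psi /psi0 -[X in _ <= X](expr0z q) r1 mulr1 => /eqP /sqrc_eq0 /eqP.
  by rewrite -normr_eq0 lf_char_unitary oner_eq0.
move=> xi.
have -> : fourierSB W psi xi = fourierSB W psi0 (xi + a).
  congr (cintegral W _); apply/funext => x.
  by rewrite /psi mulrA -lf_charD -mulrDl.
have [I [r hr]] := coset_reps_ex q_gt1 (lexx 0).
rewrite (fourierSB_step W q_gt1 _ (lexx 0) hr s0) oppr0 expr0z.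
case: ifP => [h _|]; last by rewrite eqxx.
apply/eqP; rewrite eq_le -ha; apply/andP; split.
  rewrite -(addrK a xi); apply: lf_abs_le_sub => //.
  by apply: le_trans h _; rewrite ha ltW.
have := lf_absD (xi + a) (- xi).
rewrite addrAC subrr add0r lf_absN ha le_max => /orP[h2|//].
by have := lt_le_trans q_gt1R (le_trans h2 h); rewrite ltxx.
Qed.

(** Each Delta^n acts on the wave [psi] by the scalar q^n, so that on vectors of
    multiples of [psi] the p-adic Laplacian acts as the matrix L_G(q). *)
Lemma Spec_of_eigenvector lam z :
  laplacian_eigenvector (cweight (edge_weight q)) lam z ->
  Spec W alpha G lam != 0%E.
Proof.
case=> [[a0 za0] eig]; have [psi [sb psi_n0 psi_supp]] := schwartzBruhat_on_sphere.
have F : isFourier W psi (fourierSB W psi) by apply: isFourier_schwartzBruhat.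
have vlad n c : isVladimirov W n (fun x => c * psi x)
    (fun x => (q ^+ n)%:C%C * (c * psi x)).
  exists (fun x => c * fourierSB W psi x); first exact: (isFourier_scale q_gt1 c F).
  have -> : (fun xi => (abs xi ^+ n)%:C%C * (c * fourierSB W psi xi)) =
      (fun xi => (q ^+ n)%:C%C * (c * fourierSB W psi xi)).
    apply/funext => xi; have [->|n0] := eqVneq (fourierSB W psi xi) 0.
      by rewrite !mulr0.
    by rewrite psi_supp.
  exact: (isFourier_scale q_gt1 _ (isFourier_scale q_gt1 c F)).
have psiL2 c : inL2 W (fun x => c * psi x).
  by apply: inL2_scale; apply: schwartzBruhat_inL2.
have weight (a b : vertex G) c : isWeight W alpha a b (fun x => c * psi x)
    (fun x => (edge_weight q a b)%:C%C * (c * psi x)).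
  rewrite isWeightE; case: ifPn => e.
    by rewrite (edge_weightT q e); apply: vlad.
  by rewrite (edge_weightF q e); apply: aeT => x; rewrite mul0r.
pose u (a : vertex G) (x : K) := z a * psi x.
have lap : in_eigenspace W alpha lam u.
  split=> [a|a|]; [exact: psiL2|exact/inL2_scale/psiL2|].
  exists (fun a b x => if a == b
      then \sum_c (edge_weight q a c)%:C%C * (z b * psi x)
      else - ((edge_weight q a b)%:C%C * (z b * psi x))) => [a b|a].
    rewrite /isLaplacianEntry; case: eqP => _.
      exists (fun c x => (edge_weight q a c)%:C%C * (z b * psi x)) => [c|].
        exact: weight.
      exact: eqL2_refl.
    exists (fun x => (edge_weight q a b)%:C%C * (z b * psi x)); first exact: weight.
    exact: eqL2_refl.
  apply: aeT => x; rewrite (laplacian_entries q (fun b => z b * psi x)).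
  rewrite /u mulrA -eig mulr_suml; apply: eq_bigr => b _; ring.
apply: contraTneq isT => S0.
suff : (1%:E <= 0 :> \bar R)%E by rewrite lee_fin ler10.
rewrite -S0; apply: ereal_sup_ubound; exists 1%N => //=.
exists (fun=> u) => // c c0 i; apply/eqP/negPn/negP => ci.
apply: psi_n0; apply: ae_impl (c0 a0) => x; rewrite (big_ord1) (ord1 i) in ci *.
by move=> /eqP; rewrite /u !mulf_eq0 (negbTE za0) => /orP[e|/eqP//]; rewrite e in ci.
Qed.

End SpecEigenvalues.

(** * Reconstruction of the graph *)

Section Reconstruction.
Local Open Scope ring_scope.

(** An equality alpha_ab = l alpha_cd with cd another edge would write alpha_ab as
    a sum of l copies of alpha_cd. *)
Lemma label_eq_multiple (V : finType) (alpha : V -> V -> nat) a b c d (l : nat) :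
  diffusion_parameters alpha -> no_label_is_sum alpha ->
  a != b -> c != d -> alpha a b = (l * alpha c d)%N ->
  l = 1%N /\ ((c, d) = (a, b) \/ (c, d) = (b, a)).
Proof.
move=> labels generic ab cd e.
have [h|/norP[n1 n2]] := boolP (((c, d) == (a, b)) || ((c, d) == (b, a))).
  split; last by case/orP: h => /eqP; [left|right].
  have [pos _] := labels a b ab.
  have ecd : alpha c d = alpha a b.
    have [_ ba] := labels a b ab.
    by case/orP: h => /eqP[-> ->].
  by rewrite ecd in e; nia.
case: (generic a b (nseq l (c, d)) ab).
  by move=> p /nseqP[-> _].
by rewrite big_nseq iter_addn_0 mulnC.
Qed.

(** After cancellation of the common terms, a power of q would equal at most a sum
    of fewer than q smaller powers. *)
Lemma sum_expn_dominated (T : finType) (A B : pred T) (e : T -> nat) (q : nat) p :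
  (#|T| < q)%N -> (\sum_(i | A i) q ^ e i = \sum_(i | B i) q ^ e i)%N ->
  A p -> ~~ B p -> (forall i, B i -> ~~ A i -> (e i < e p)%N) -> False.
Proof.
move=> Tq eqs Ap Bp lt.
have q0 : (0 < q)%N by apply: leq_ltn_trans Tq.
move: eqs; rewrite (bigID B) [RHS](bigID A) /=.
rewrite (eq_bigl (fun i => B i && A i)) => [/addnI eqs|i]; last exact: andbC.
have lo : (q ^ e p <= \sum_(i | A i && ~~ B i) q ^ e i)%N.
  by rewrite (bigD1 p) /= ?Ap // leq_addr.
have ep0 : (#|T| * q ^ (e p).-1 < q ^ e p)%N \/ e p = 0%N.
  case: (e p) => [|n]; first by right.
  by left; rewrite /= expnS ltn_pmul2r // expn_gt0 q0.
have hi : (\sum_(i | B i && ~~ A i) q ^ e i <= #|T| * q ^ (e p).-1)%N.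
  rewrite big_mkcond /= -sum_nat_const; apply: leq_sum => i _.
  case: ifP => // /andP[Bi Ai]; rewrite leq_pexp2l //.
  by have := lt i Bi Ai; case: (e p).
case: ep0 => [h|e0]; first by move: (leq_trans lo (eq_leq eqs)); lia.
move: eqs; rewrite [RHS]big1 => [s0|i /andP[Bi Ai]]; last first.
  by have := lt i Bi Ai; rewrite e0.
by move: lo; rewrite s0 leqn0 expn_eq0 e0 andbF.
Qed.

Section TwoGraphs.
Variables (R : realType) (K : localField R) (W : fourierData K).
Variables (V : finType) (alpha : V -> V -> nat).
Hypothesis labels : diffusion_parameters alpha.
Hypothesis generic : no_label_is_sum alpha.
Hypothesis q_large : (64 * #|V| ^ 5 + #|V| ^ 2 + 1 < lf_card K)%N.

Local Notation q := ((lf_card K)%:R : R).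
Local Notation abs := (@lf_abs R K).

Let q_gt1 : (1 < lf_card K)%N.
Proof. by apply: leq_trans q_large; rewrite !addn1. Qed.

Let q_gt0 : 0 < q := lt_trans ltr01 (residue_card_gt1 q_gt1).

Lemma edge_neq (G : graph V) a b : edge G a b -> a != b.
Proof. by apply: contraTneq => ->; rewrite edge_irr. Qed.

Lemma edge_weight_ge0 (G : graph V) (t : R) (a b : vertex G) :
  0 <= t -> 0 <= edge_weight alpha t a b.
Proof. by move=> t0; rewrite /edge_weight; case: ifP => // _; apply: exprn_ge0. Qed.

Lemma edge_weightC (G : graph V) (t : R) (a b : vertex G) :
  edge_weight alpha t a b = edge_weight alpha t b a.
Proof.
rewrite /edge_weight edge_sym; case: ifP => // e.
by have [_ ->] := labels (edge_neq e).
Qed.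

Lemma edge_weight_gt0 (G : graph V) (t : R) (a b : vertex G) :
  0 < edge_weight alpha t a b -> edge G (val a) (val b).
Proof. by apply: contraTT => e; rewrite (edge_weightF _ _ e) ltxx. Qed.

(** If q^s and q^t both have the order of magnitude of [lam], they differ by a
    factor at most 64 N^5, where N is the cardinality of [V]; this is less than q. *)
Lemma band_exponents (n n' : nat) (lam : R) (s t : int) :
  (n <= #|V|)%N -> (n' <= #|V|)%N ->
  in_band n lam (q ^ s) -> in_band n' lam (q ^ t) -> s = t.
Proof.
suff le n1 n2 s1 t1 : (n1 <= #|V|)%N -> (n2 <= #|V|)%N ->
    q ^ s1 <= 8 * n1%:R ^+ 3 * lam -> lam <= 8 * n2%:R ^+ 2 * q ^ t1 -> s1 <= t1.
  move=> h1 h2 [a1 a2] [b1 b2]; apply/eqP; rewrite eq_le.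
  by rewrite (le n n') // (le n' n).
move=> h1 h2 a b; rewrite -ltzD1 -(@ltr_eXz2l _ q) ?residue_card_gt1 //.
apply: (@le_lt_trans _ _ ((64 * #|V| ^ 5)%N%:R * q ^ t1)).
  apply: (le_trans a).
  apply: (@le_trans _ _ (8 * n1%:R ^+ 3 * (8 * n2%:R ^+ 2 * q ^ t1))).
    by rewrite ler_wpM2l // mulr_ge0 // exprn_ge0.
  rewrite [X in X <= _]mulrA; apply: ler_wpM2r; first by rewrite ltW // exprz_gt0.
  rewrite -!natrX -!natrM ler_nat.
  have e1 : (n1 ^ 3 <= #|V| ^ 3)%N by rewrite leq_exp2r.
  have e2 : (n2 ^ 2 <= #|V| ^ 2)%N by rewrite leq_exp2r.
  have -> : (#|V| ^ 5 = #|V| ^ 3 * #|V| ^ 2)%N by rewrite -expnD.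
  have := leq_mul e1 e2; lia.
rewrite expfzDr ?gt_eqF // expr1z mulrC ltr_pM2l ?exprz_gt0 // ltr_nat; lia.
Qed.

Lemma card_vertex (G : graph V) : (#|{: vertex G}| <= #|V|)%N.
Proof. by rewrite card_sig; apply: max_card. Qed.

Lemma band_pos (n : nat) (lam v : R) : (0 < n)%N -> lam != 0 -> 0 <= v ->
  in_band n lam v -> 0 < lam /\ 0 < v.
Proof.
move=> n0 l0 v0 [h1 h2].
have c0 : 0 < 8 * n%:R ^+ 2 :> R by rewrite mulr_gt0 // exprn_gt0 // ltr0n.
have d0 : 0 < 8 * n%:R ^+ 3 :> R by rewrite mulr_gt0 // exprn_gt0 // ltr0n.
have lam_gt0 : 0 < lam.
  by rewrite lt_neqAle eq_sym l0 /= -(pmulr_rge0 _ d0) (le_trans v0).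
by split=> //; rewrite -(pmulr_rgt0 _ c0) (lt_le_trans lam_gt0).
Qed.

Lemma one_edge_in_band (G : graph V) (lam : R) (a b c d : vertex G) :
  lam != 0 -> in_band #|{: vertex G}| lam (edge_weight alpha q a b) ->
  in_band #|{: vertex G}| lam (edge_weight alpha q c d) ->
  (c, d) = (a, b) \/ (c, d) = (b, a).
Proof.
move=> l0 hab hcd.
have n0 : (0 < #|{: vertex G}|)%N by apply/card_gt0P; exists a.
have w0 (u v : vertex G) := edge_weight_ge0 u v (ltW q_gt0).
have [_ /edge_weight_gt0 eab] := band_pos n0 l0 (w0 a b) hab.
have [_ /edge_weight_gt0 ecd] := band_pos n0 l0 (w0 c d) hcd.
rewrite (edge_weightT _ _ eab) in hab; rewrite (edge_weightT _ _ ecd) in hcd.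
have [e] := band_exponents (s := (alpha (val a) (val b))%:Z)
  (t := (alpha (val c) (val d))%:Z) (card_vertex G) (card_vertex G) hab hcd.
have [] := label_eq_multiple (l := 1) labels generic (edge_neq eab) (edge_neq ecd).
  by rewrite mul1n.
by move=> _ [] [/val_inj -> /val_inj ->]; [left|right].
Qed.

Lemma vertex_laplacian_simple (G : graph V) (lam : R) (x y : vertex G -> R[i]) :
  let L := laplacian (cweight (edge_weight alpha q)) in
  lam != 0 ->
  (forall a, L x a = lam%:C%C * x a) -> (forall a, L y a = lam%:C%C * y a) ->
  exists s t : R[i], ((s != 0) || (t != 0)) /\ forall a, s * x a + t * y a = 0.
Proof.
move=> L l0; apply: eigenvalue_simple => //.
- by move=> a b; apply: edge_weight_ge0; apply: ltW.
- exact: edge_weightC.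
- by move=> a b c d; apply: one_edge_in_band.
Qed.

(** The spectrum of H only says that [lam] is an eigenvalue of L_H(q^k) for some k;
    comparing its order of magnitude with that in L_G(q) forces k = 1. *)
Lemma same_eigenvalues (G H : graph V) (lam : R) :
  Spec W alpha G = Spec W alpha H -> lam != 0 ->
  (exists x : vertex G -> R, laplacian_eigenvector (edge_weight alpha q) lam x) ->
  exists y : vertex H -> R, laplacian_eigenvector (edge_weight alpha q) lam y.
Proof.
move=> GH l0 [x hx].
have [[v xv] eigx] := hx.
have [lam_gt0 [a [b hab]]] := eigenvalue_scale
  (fun a b => edge_weight_ge0 a b (ltW q_gt0)) (edge_weightC q) eigx l0 xv.
have lC0 : lam%:C%C != 0 :> R[i] by apply: contra l0 => /eqP[->].
have := Spec_of_eigenvector W q_gt1 (complex_eigenvector hx).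
rewrite GH => /(eigenvector_of_Spec q_gt1 lC0) [xi [z /real_eigenvector [y hy]]].
have [[v' yv'] eigy] := hy.
have [_ [c [d hcd]]] := eigenvalue_scale
  (fun a b => edge_weight_ge0 a b (lf_abs_ge0 xi)) (edge_weightC (abs xi)) eigy l0 yv'.
have nG : (0 < #|{: vertex G}|)%N by apply/card_gt0P; exists a.
have nH : (0 < #|{: vertex H}|)%N by apply/card_gt0P; exists c.
have [_ /edge_weight_gt0 eab] := band_pos nG l0 (edge_weight_ge0 a b (ltW q_gt0)) hab.
have [_ wcd] := band_pos nH l0 (edge_weight_ge0 c d (lf_abs_ge0 xi)) hcd.
have ecd := edge_weight_gt0 wcd.
rewrite (edge_weightT _ _ eab) in hab; rewrite (edge_weightT _ _ ecd) in hcd wcd.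
have [acd _] := labels (edge_neq ecd); have [aab _] := labels (edge_neq eab).
have xi0 : xi != 0.
  by apply: contraTneq wcd => ->; rewrite lf_abs0 expr0n eqn0Ngt acd ltxx.
have [k hk] := lf_discrete xi0.
have hcd' : in_band #|{: vertex H}| lam (q ^ (k * (alpha (val c) (val d))%:Z)).
  by rewrite -exprz_exp -hk.
have e : (alpha (val a) (val b))%:Z = k * (alpha (val c) (val d))%:Z :=
  band_exponents (s := (alpha (val a) (val b))%:Z)
    (card_vertex G) (card_vertex H) hab hcd'.
have k_ge0 : 0 <= k.
  by rewrite -(@pmulr_lge0 _ (alpha (val c) (val d))%:Z) ?ltz_nat // -e.
have [l kl] : exists l : nat, k = l%:Z by exists `|k|%N; rewrite gez0_abs.
have e' : alpha (val a) (val b) = (l * alpha (val c) (val d))%N.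
  by move: e; rewrite kl -PoszM => -[].
have [l1 _] :=
  label_eq_multiple labels generic (edge_neq eab) (edge_neq ecd) e'.
by exists y; rewrite hk kl l1 expr1z in hy.
Qed.

Lemma trace_vertex_edges (G : graph V) :
  \sum_(a : vertex G) \sum_(b : vertex G) edge_weight alpha q a b
    = (\sum_(p : V * V | edge G p.1 p.2) lf_card K ^ alpha p.1 p.2)%N%:R.
Proof.
have sub (F : V -> R) : (forall v, v \notin vertices G -> F v = 0) ->
    \sum_(a : vertex G) F (val a) = \sum_v F v.
  move=> F0; rewrite [RHS](bigID (mem (vertices G))) /= [X in _ + X]big1 ?addr0 //.
  exact: esym (big_sub (vertices G) F).
rewrite natr_sum -(pair_big_dep xpredT (edge G)
  (fun a b => ((lf_card K ^ alpha a b)%N)%:R : R)) /=.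
rewrite -(sub (fun a => \sum_(b | edge G a b) ((lf_card K ^ alpha a b)%N)%:R)).
  apply: eq_bigr => a _; rewrite [RHS]big_mkcond /=.
  rewrite -(sub (fun b => if edge G (val a) b
      then ((lf_card K ^ alpha (val a) b)%N)%:R else 0)) => [|v nv].
    by apply: eq_bigr => b _; rewrite natrX.
  by case: ifP => // /edge_vertices /andP[_]; rewrite (negbTE nv).
move=> v nv; rewrite big1 // => b /edge_vertices /andP[].
by rewrite (negbTE nv).
Qed.

Lemma same_trace (G H : graph V) : Spec W alpha G = Spec W alpha H ->
  (\sum_(p : V * V | edge G p.1 p.2) lf_card K ^ alpha p.1 p.2
    = \sum_(p : V * V | edge H p.1 p.2) lf_card K ^ alpha p.1 p.2)%N.
Proof.
move=> GH; apply/eqP; rewrite -(eqr_nat R) -!trace_vertex_edges; apply/eqP.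
have tr (F : graph V) := @trace_from_spectrum R (vertex F) (edge_weight alpha q)
  (edge_weightC q) (edge_weight_diag alpha q) (@vertex_laplacian_simple F).
have [s [us sG <-]] := tr G; have [t [ut tH <-]] := tr H.
apply: perm_big; apply: uniq_perm => // lam; apply/idP/idP.
  by move=> /sG [l0 ex]; apply/tH; split=> //; apply: same_eigenvalues ex.
by move=> /tH [l0 ex]; apply/sG; split=> //; apply: same_eigenvalues ex.
Qed.

(** At a pair of maximal label among those where the graphs differ, the equality
    of traces fails. *)
Lemma same_edges (G H : graph V) : Spec W alpha G = Spec W alpha H ->
  edge G =2 edge H.
Proof.
suff sub (F F' : graph V) (a b : V) : Spec W alpha F = Spec W alpha F' ->
    (forall c d, edge F c d != edge F' c d -> alpha c d <= alpha a b)%N ->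
    edge F a b -> edge F' a b.
  move=> GH; pose D := [pred p : V * V | edge G p.1 p.2 != edge H p.1 p.2].
  have [p0 Dp0|D0] := pickP D; last first.
    by move=> a b; have /negbFE/eqP := D0 (a, b).
  exfalso; case: (arg_maxnP (fun p => alpha p.1 p.2) Dp0) => -[a b] /= Dab max.
  case/negP: Dab; apply/eqP; apply/idP/idP.
    by apply: sub => // c d; apply: (max (c, d)).
  by apply: sub => [//|c d]; rewrite eq_sym; apply: (max (c, d)).
move=> /same_trace tr max Fab; apply/negPn/negP => nab.
have card_q : (#|{: V * V}| < lf_card K)%N.
  by rewrite card_prod; apply: leq_ltn_trans q_large; lia.
apply: (sum_expn_dominated (p := (a, b)) card_q tr) => // -[c d] /= F'cd nFcd.
rewrite ltn_neqAle max ?F'cd ?(negbTE nFcd) // andbT; apply/eqP => e.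
have [|_] := label_eq_multiple (l := 1) labels generic (edge_neq F'cd) (edge_neq Fab).
  by rewrite mul1n.
case=> -[ea eb]; first by rewrite ea eb F'cd in nab.
by rewrite ea eb edge_sym F'cd in nab.
Qed.

(** With an edge, each vertex of a connected graph is an end of some edge, so that
    equal edges give equal vertices.  Without an edge, both graphs are single
    vertices, possibly different elements of [V]. *)
Lemma cospectral_isomorphic (G H : graph V) :
  connected_graph G -> connected_graph H ->
  Spec W alpha G = Spec W alpha H -> isomorphic alpha G H.
Proof.
move=> cG cH /same_edges GH.
have sub (F F' : graph V) : edge F =2 edge F' -> connected_graph F ->
    [exists a, exists b, edge F a b] ->
    forall v, v \in vertices F -> v \in vertices F'.
  move=> FF' [_ conn] /existsP[a /existsP[b ab]] v vF.
  have /andP[aF bF] := edge_vertices ab.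
  have [u uF vu] : exists2 u, u \in vertices F & v != u.
    have [va|va] := eqVneq v a; last by exists a.
    by exists b => //; rewrite va (edge_neq ab).
  have /connectP[[|x p] /=] := conn v u vF uF.
    by move=> _ e; rewrite e eqxx in vu.
  by case/andP; rewrite FF' => /edge_vertices/andP[].
have [ex|/existsPn no] := boolP [exists a, exists b, edge G a b].
  have exH : [exists a, exists b, edge H a b].
    have /existsP[a /existsP[b ab]] := ex.
    by apply/existsP; exists a; apply/existsP; exists b; rewrite -GH.
  have sGH := sub G H GH cG ex.
  have sHG := sub H G (fun a b => esym (GH a b)) cH exH.
  exists (fun a : vertex G => exist _ (val a) (sGH _ (valP a)) : vertex H).
    exists (fun a : vertex H => exist _ (val a) (sHG _ (valP a)) : vertex G).
      by move=> a; apply: val_inj.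
    by move=> a; apply: val_inj.
  by move=> a b; rewrite /= GH.
have noG a b : edge G a b = false.
  by have /existsPn/(_ b)/negbTE := no a.
have noH a b : edge H a b = false by rewrite -GH.
have single (F : graph V) : connected_graph F -> (forall a b, edge F a b = false) ->
    exists a : vertex F, forall b : vertex F, b = a.
  move=> [/set0Pn[a aF] conn] noF; exists (exist _ a aF) => -[b bF].
  apply: val_inj => /=; have /connectP[[|x p] /=] := conn a b aF bF => //.
  by rewrite noF.
have [g Gg] := single G cG noG; have [h Hh] := single H cH noH.
exists (fun=> h); last by move=> a b; rewrite noG noH.
by exists (fun=> g) => a; rewrite ?(Gg a) ?(Hh a).
Qed.

End TwoGraphs.
End Reconstruction.

Definition empty_graph (V : finType) : graph V.
Proof. by refine (@Graph V finset.set0 (fun _ _ => false) _ _ _). Defined.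

Theorem corollary4p9 (R : realType)
    (K : prime_number -> localField R) (W : forall p, fourierData (K p))
    (residue_char : forall p, exists2 f : nat, (0 < f)%N &
       lf_card (K p) = (val p ^ f)%N)
    (V : finType) (alpha : V -> V -> nat)
    (labels : diffusion_parameters alpha)
    (generic : no_label_is_sum alpha) :
  exists (ps : seq prime_number) (rec : seq (R[i] -> \bar R) -> graph V),
    reconstructs W alpha ps rec.
Proof.
have [p p_large p_prime] := prime_above (64 * #|V| ^ 5 + #|V| ^ 2 + 1).
pose P : prime_number := exist _ p p_prime.
have q_large : (64 * #|V| ^ 5 + #|V| ^ 2 + 1 < lf_card (K P))%N.
  have [f f0 ->] := residue_char P; apply: (leq_trans p_large).
  by rewrite -{1}(expn1 p) /= leq_exp2l // prime_gt1.
pose is_play (l : seq (R[i] -> \bar R)) (G : graph V) :=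
  connected_graph G /\ [seq Spec (W p) alpha G | p <- [:: P]] = l.
exists [:: P], (fun l => match pselect (exists G, is_play l G) with
  | left h => projT1 (cid h) | right _ => empty_graph V end) => G cG.
case: pselect => [h|[]]; last by exists G.
case: (cid h) => H /= [cH [HG]].
exact: (cospectral_isomorphic labels generic q_large cG cH (esym HG)).
Qed.
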